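(* Let $(x(\cdot),z(\cdot))$ be an extremizer to the higher-order Herglotz problem $(H_n)$ that satisfies the initial conditions $$x(a)=\alpha_0,\ \ldots,\ x^{(n-1)}(a)=\alpha_{n-1},\qquad \alpha_0,\ldots,\alpha_{n-1}\in\mathbb{R}^m .$$ Then the Euler--Lagrange equation $$\sum_{j=0}^n(-1)^j\frac{d^j}{dt^j}\left(\psi_z(t)\frac{\partial L}{\partial x^{(j)}}\langle x,z\rangle_n(t)\right)=0$$ holds, for $t\in[a,b]$, where $$\psi_z(t)=e^{\int_t^b\frac{\partial L}{\partial z}\langle x,z\rangle_n(\theta)\,d\theta},\qquad \psi_j(t)=\sum_{i=0}^{n-j}(-1)^{i+1}\frac{d^i}{dt^i}\left(\psi_z(t)\frac{\partial L}{\partial x^{(i+j)}}\langle x,z\rangle_n(t)\right),\quad j=1,\ldots,n .$$ Moreover, the following transversality conditions hold: $$\psi_j(b)=0,\qquad j=1,\ldots,n.$$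
   Context: Let $a<b$ be reals, $n,m\ge 1$ integers, $\gamma\in\mathbb{R}$, and $L\in C^1([a,b]\times\mathbb{R}^{(n+1)m+1};\mathbb{R})$, with arguments written $L(t,x,\dot x,\ldots,x^{(n)},z)$, where $x^{(j)}\in\mathbb{R}^m$ ($x^{(0)}=x$) and $z\in\mathbb{R}$; $\frac{\partial L}{\partial x^{(j)}}$ is the $\mathbb{R}^m$-valued partial gradient. Notation: $\langle x,z\rangle_n(t):=(t,x(t),\dot x(t),\ldots,x^{(n)}(t),z(t))$. Function classes: $PC$ stands for piecewise continuous (finitely many discontinuities, with finite one-sided limits); $PC^1$ means continuous with a piecewise continuous derivative (existing except possibly at finitely many points); $PC^n$ means of class $C^{n-1}$ with $(n-1)$-th derivative in $PC^1$. Problem $(H_n)$: $z(b)\to\text{extr}$ (minimum or maximum), with $\dot z(t)=L(t,x(t),\dot x(t),\ldots,x^{(n)}(t),z(t))$, $t\in[a,b]$, subject to $z(a)=\gamma$. Admissible pair to $(H_n)$: a pair $(x(\cdot),z(\cdot))$ with $x\in PC^n([a,b];\mathbb{R}^m)$ and $z\in PC^1([a,b];\mathbb{R})$ satisfying $\dot z(t)=L\langle x,z\rangle_n(t)$, $t\in[a,b]$, and $z(a)=\gamma$. Extremizer to $(H_n)$: an admissible pair $(x^*(\cdot),z^*(\cdot))$ such that, for some real $\epsilon>0$, $z(b)-z^*(b)$ has the same sign (always $\ge 0$, or always $\le 0$) for all admissible pairs $(x(\cdot),z(\cdot))$ that satisfy $\|z-z^*\|_0<\epsilon$ and $\|x-x^*\|_0<\epsilon$,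 where $\|y\|_0=\max_{a\le t\le b}|y(t)|$.
   Formalization: As the termwise derivatives need not exist, the Euler–Lagrange sum and ψ_j are read in nested form g0−d/dt(g1−d/dt(…)) with piecewise C^1 inner terms, off finitely many t; the displayed sums hold at every t of any subinterval where each ψ_z ∂L/∂x^(j) is C^j. *)

(* Defs.v *)
From HB Require Import structures.
From mathcomp Require Import all_boot all_order all_algebra.
From mathcomp Require Import all_classical all_reals all_analysis.

Set Implicit Arguments.
Unset Strict Implicit.
Unset Printing Implicit Defensive.

Import Order.TTheory GRing.Theory Num.Theory.
Import numFieldNormedType.Exports.

Local Open Scope classical_set_scope.
Local Open Scope ring_scope.

(** * Derivatives relative to a set

    [derivable] and ['D_v f p] with the difference quotient restricted to the
    points of [S]: one-sided derivatives at the end points of an interval. *)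

Section RelativeDerivative.
Context {R : realType} {V W : normedModType R}.
Implicit Types (S : set V) (f : V -> W).

Definition derivable_on S f (p v : V) : Prop :=
  cvg ((fun h : R => h^-1 *: (f (p + h *: v) - f p))
         @ within [set h | S (p + h *: v)] 0^').

Definition derive_on S f (p v : V) : W :=
  lim ((fun h : R => h^-1 *: (f (p + h *: v) - f p))
         @ within [set h | S (p + h *: v)] 0^').

(* Asking for all directions [v], rather than the coordinate ones, amounts to
   the same on the domain [a, b] x R^N where this is used. *)
Definition C1_on S f : Prop :=
  {within S, continuous f} /\
  forall v, (forall p, S p -> derivable_on S f p v) /\
            {within S, continuous (fun p => derive_on S f p v)}.

End RelativeDerivative.

(** * Function classes on [a, b] *)

Section FunctionClasses.
Context {R : realType}.
Variables a b : R.

Definition but_finitely (P : R -> Prop) : Prop :=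
  finite_set [set t | t \in `[a, b] /\ ~ P t].

Context {V : normedModType R}.
Implicit Type f : R -> V.

Definition D1 f (t : R) : V := derive_on [set` `[a, b]] f t 1.

Definition Dn (j : nat) f : R -> V := iter j D1 f.

Definition Ck (k : nat) f : Prop :=
  (forall j t, (j < k)%N -> t \in `[a, b] ->
     derivable_on [set` `[a, b]] (Dn j f) t 1) /\
  (forall j, (j <= k)%N -> {within [set` `[a, b]], continuous (Dn j f)}).

Definition PC f : Prop :=
  [/\ but_finitely (fun t => {for t, continuous f}),
      forall t, t \in `[a, b[ -> cvg (f @ t^'+) &
      forall t, t \in `]a, b] -> cvg (f @ t^'-)].

(* [D1 f] is a default value at the exceptional points, which is harmless since
   [PC] does not see the values of a function at finitely many points. *)
Definition PC1 f : Prop :=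
  [/\ {within [set` `[a, b]], continuous f},
      but_finitely (fun t => derivable_on [set` `[a, b]] f t 1) &
      PC (D1 f)].

Definition PCn (n : nat) f : Prop := Ck n.-1 f /\ PC1 (Dn n.-1 f).

Definition norm0 f : R := sup [set `|f t| | t in [set` `[a, b]]].

(* [alt_dsum k g F]: the function F is \sum_(i <= k) (-1)^i d^i/dt^i (g i).
   For merely piecewise continuous g i the individual terms need not exist; the
   sum is read in nested form,
     g 0 - d/dt (g 1 - d/dt (g 2 - ... - d/dt (g k))),
   each expression under a d/dt being required to be (up to its values at
   finitely many points) a PC^1 function. *)
Fixpoint alt_dsum (k : nat) (g : nat -> R -> V) (F : R -> V) : Prop :=
  if k is k'.+1 then
    exists H : R -> V,
      [/\ PC1 H, alt_dsum k' (fun i => g i.+1) H &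
          but_finitely (fun t => F t = g 0%N t - D1 H t)]
  else but_finitely (fun t => F t = g 0%N t).

End FunctionClasses.

(** * The higher-order Herglotz problem *)

Section Herglotz.
Context {R : realType} {n m : nat}.

(* Points (t, X, z); row j of X is the argument x^(j). *)
Definition Larg : normedModType R := (R * 'M[R]_(n.+1, m) * R)%type.

Variables (a b gamma : R) (L : Larg -> R).

Definition Ldom : set Larg := [set p | p.1.1 \in `[a, b]].

(* Ldom is not bounded in the x^(j) and z directions, so that the derivatives
   below only depend on L on Ldom. *)
Definition dLdx (j : 'I_n.+1) (p : Larg) : 'rV[R]_m :=
  \row_k 'D_((0, delta_mx j k, 0) : Larg) L p.

Definition dLdz (p : Larg) : R := 'D_((0, 0, 1) : Larg) L p.

Definition jet (x : R -> 'rV[R]_m) (z : R -> R) (t : R) : Larg :=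
  (t, \matrix_(j < n.+1) Dn a b j x t, z t).

Definition admissible (x : R -> 'rV[R]_m) (z : R -> R) : Prop :=
  [/\ PCn a b n x, PC1 a b z,
      but_finitely a b (fun t => D1 a b z t = L (jet x z t)) &
      z a = gamma].

Definition extremizer (xs : R -> 'rV[R]_m) (zs : R -> R) : Prop :=
  admissible xs zs /\
  exists2 eps : R, 0 < eps &
    let near_adm x z := [/\ admissible x z,
        norm0 a b (z \- zs) < eps & norm0 a b (x \- xs) < eps] in
    (forall x z, near_adm x z -> 0 <= z b - zs b) \/
    (forall x z, near_adm x z -> z b - zs b <= 0).

Definition psiz (x : R -> 'rV[R]_m) (z : R -> R) (t : R) : R :=
  expR (\int[lebesgue_measure]_(theta in `[t, b]) dLdz (jet x z theta)).

(* Only meaningful for j <= n. *)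
Definition momentum (x : R -> 'rV[R]_m) (z : R -> R) (j : nat) (t : R) :
    'rV[R]_m :=
  psiz x z t *: dLdx (inord j) (jet x z t).

End Herglotz.

(* Main.v *)
Require Import Defs.
From HB Require Import structures.
From mathcomp Require Import all_boot all_order all_algebra.
From mathcomp Require Import all_classical all_reals all_analysis.
From mathcomp Require Import ring lra.

Set Implicit Arguments.
Unset Strict Implicit.
Unset Printing Implicit Defensive.

Import Order.TTheory GRing.Theory Num.Theory.
Import numFieldNormedType.Exports.

Local Open Scope classical_set_scope.
Local Open Scope ring_scope.

(** Write [G j] for the momenta.  Define [H 0 = 0] and, backwards from [b],
    [H (j+1)' = G j - H j] with [H (j+1) b = 0]; then [psi_j = - H j], and all
    the claims reduce to [G n = H n] off a finite set.  Put [d = G n - H n] and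
    let [h] be the [n]-fold primitive of [d] vanishing at [a] with its first
    [n - 1] derivatives; admissible pairs carry no condition on [x], so
    [x + s h] is an allowed variation.  Picard iteration solves the perturbed
    equation as [z + W s] with [W s = O(s)], and multiplying [W s] by the
    integrating factor [psiz] gives [W s b = s Q + o(s)], where [Q] is the
    integral of the sum of the [G j . h^(j)].  Extremality forces [Q = 0], while
    integration by parts turns [Q] into the integral of [|d|^2].  Integrals are
    handled as continuous functions differentiable off a finite set, and
    inequalities between them follow from monotonicity. *)

(** * Properties with finitely many exceptions *)

(** The momenta are only piecewise continuous, so the derivatives in the Euler--Lagrange equation
    cannot be taken for granted. The integration by parts therefore integrates the momenta and
    differentiates only the variation; the nested derivatives exist as a conclusion, each [H (j+1)]
    being differentiable off a finite set by construction. [H 0 = 0] is the equation itself, and the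
    normalization at [b] is the transversality condition: the boundary terms [H (j+1) . h^(j)]
    vanish at [b] thanks to [H] and at [a] thanks to [h]. Two obstacles shape the analysis. [L] is
    merely of class [C^1], so the perturbed equation is only locally Lipschitz in [z], and a
    solution reaching [b] must be secured. Moreover the jet of [x] may jump, so its range need not
    be compact; the uniform estimates on the partial derivatives of [L] have to include its
    one-sided limits. *)

Section FiniteExceptions.
Context {R : realType}.
Implicit Types (a b c d t : R) (P Q : R -> Prop).

(** The end points join the exceptional set, so the implication is asked only at interior points,
    where one-sided and two-sided derivatives agree. *)
Lemma but_finitely_imp a b P Q :
  (forall t, t \in `]a, b[ -> P t -> Q t) ->
  but_finitely a b P -> but_finitely a b Q.
Proof.
move=> PQ fP; apply: (@sub_finite_set _ _
  ([set t | t \in `[a, b] /\ ~ P t] `|` [set` [:: a; b]])); last first.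
  by rewrite finite_setU; split => //; exact: finite_seq.
move=> t [tab nQ]; case: (pselect (t \in `]a, b[)) => tab'.
  by left; split => // /(PQ _ tab').
right; rewrite /= !inE; move: tab tab'; rewrite !in_itv/=.
move=> /andP[]; rewrite le_eqVlt => /orP[/eqP->|ta]; first by rewrite eqxx.
by rewrite le_eqVlt => /orP[/eqP->|tb]; rewrite ?eqxx ?orbT// ta tb.
Qed.

Lemma but_finitelyT a b P : (forall t, t \in `]a, b[ -> P t) ->
  but_finitely a b P.
Proof.
move=> h; apply: (@but_finitely_imp _ _ xpredT) => [t /h//|].
rewrite /but_finitely (_ : [set _ | _] = set0)//.
by apply/seteqP; split => t //= [].
Qed.

Lemma but_finitely_and a b P Q : but_finitely a b P -> but_finitely a b Q ->
  but_finitely a b (fun t => P t /\ Q t).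
Proof.
move=> fP fQ; apply: (@sub_finite_set _ _
  ([set t | t \in `[a, b] /\ ~ P t] `|` [set t | t \in `[a, b] /\ ~ Q t])).
  move=> t [tab nPQ]; case: (pselect (P t)) => Pt; [right|left] => //.
  by split => // Qt; apply: nPQ.
by rewrite finite_setU.
Qed.

Lemma but_finitely_imp2 a b P Q S :
  (forall t, t \in `]a, b[ -> P t -> Q t -> S t) ->
  but_finitely a b P -> but_finitely a b Q -> but_finitely a b S.
Proof.
move=> h fP fQ; apply: but_finitely_imp (but_finitely_and fP fQ).
by move=> t tab []; exact: h.
Qed.

Lemma but_finitely_forall (I : finType) a b (P : I -> R -> Prop) :
  (forall i, but_finitely a b (P i)) ->
  but_finitely a b (fun t => forall i, P i t).
Proof.
move=> h; suff : forall s : seq I,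
    but_finitely a b (fun t => forall i, i \in s -> P i t).
  move/(_ (enum I)); apply: but_finitely_imp => t _ + i; apply.
  by rewrite mem_enum.
elim=> [|i s IHs]; first exact: but_finitelyT.
apply: but_finitely_imp2 (h i) IHs => t _ Pit Pst j.
by rewrite inE => /orP[/eqP->|/Pst].
Qed.

Lemma but_finitelyW a b c d P : a <= c -> d <= b ->
  but_finitely a b P -> but_finitely c d P.
Proof.
move=> ac db; apply: sub_finite_set => t [tcd nP]; split => //.
move: tcd; rewrite !in_itv/= => /andP[ct td].
by rewrite (le_trans ac ct) (le_trans td db).
Qed.

(** The exceptional set without [t] is finite, hence closed, so its complement is a neighbourhood of
    [t]. *)
Lemma but_finitely_near a b P t : but_finitely a b P ->
  \forall s \near t^', s \in `[a, b] -> P s.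
Proof.
move=> fP; pose E := [set t | t \in `[a, b] /\ ~ P t] `\ t.
have fE : finite_set E by apply: sub_finite_set fP => s [].
have cE : closed E.
  by apply: (@accessible_finite_set_closed R).1 => //; exact: hausdorff_accessible.
rewrite near_withinE; have : nbhs t (~` E).
  by apply: open_nbhs_nbhs; split; [exact: closed_openC|move=> [] _ /=; exact].
apply: filterS => s Es st sab; apply: contrapT => nP; apply: Es; split => //=.
exact/eqP.
Qed.

Lemma nbhs_left_right t P : (\forall s \near t^'-, P s) ->
  (\forall s \near t^'+, P s) -> P t -> \forall s \near t, P s.
Proof.
rewrite !near_withinE => Pl Pr Pt; near=> s.
have [st|st|->//] := ltgtP s t.
- by move: st; near: s.
- by move: st; near: s.
Unshelve. all: by end_near. Qed.

Lemma at_left_dnbhs t P : (\forall s \near t^', P s) -> \forall s \near t^'-, P s.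
Proof. by rewrite !near_withinE; apply: filterS => s h /lt_eqF/negbT; exact: h. Qed.

Lemma at_right_dnbhs t P : (\forall s \near t^', P s) -> \forall s \near t^'+, P s.
Proof. by rewrite !near_withinE; apply: filterS => s h /gt_eqF/negbT; exact: h. Qed.

Lemma at_left_itv a b t : t \in `]a, b] -> \forall s \near t^'-, s \in `]a, b[.
Proof.
rewrite in_itv/= => /andP[ta tb]; near=> s; rewrite in_itv/=; apply/andP; split.
  by near: s; exact: nbhs_left_gt.
by apply: lt_le_trans tb; near: s; exact: nbhs_left_lt.
Unshelve. all: by end_near. Qed.

Lemma at_right_itv a b t : t \in `[a, b[ -> \forall s \near t^'+, s \in `]a, b[.
Proof.
rewrite in_itv/= => /andP[ta tb]; near=> s; rewrite in_itv/=; apply/andP; split.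
  by apply: le_lt_trans ta _; near: s; exact: nbhs_right_gt.
by near: s; exact: nbhs_right_lt.
Unshelve. all: by end_near. Qed.

(** Compactness in its near-covering form, along the filter of radii tending to 0 from the right;
    monotonicity makes a local radius good for all smaller ones. *)
Lemma uniform_on_segment a b (Q : R -> R -> Prop) :
  (forall t r r', 0 < r' <= r -> Q t r -> Q t r') ->
  (forall t0, t0 \in `[a, b] ->
     exists2 r, 0 < r & \forall t \near t0, t \in `[a, b] -> Q t r) ->
  exists2 r, 0 < r & forall t, t \in `[a, b] -> Q t r.
Proof.
move=> Qmon loc.
have := (compact_near_coveringP _).1 (@segment_compact R a b) R (0^'+)
  (fun r t => 0 < r -> t \in `[a, b] -> Q t r) _.
move=> /(_ _)[].
  move=> t0 /= t0ab; have [r r0 Hr] := loc _ t0ab.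
  exists ([set t | t \in `[a, b] -> Q t r], [set r' | r' <= r]).
    by split => //=; exact: nbhs_right_le.
  move=> [t r'] [/= Qt r'r] r'0 tab.
  by apply: (@Qmon _ r); [rewrite r'0|exact: Qt].
move=> e/= e0 He.
exists (e / 2); first by rewrite divr_gt0.
move=> t tab; apply: (He (e/2)) => //=.
- by rewrite sub0r normrN gtr0_norm ?divr_gt0// ltr_pdivrMr// ltr_pMr// ltr1n.
- by rewrite divr_gt0.
- by rewrite divr_gt0.
Qed.

End FiniteExceptions.

(** * Piecewise continuous functions *)

Section PiecewiseContinuous.
Context {R : realType}.
Variables a b : R.
Hypothesis ab : a < b.
Implicit Types (V W : normedModType R) (t : R).

Lemma cvg_within_comp (T U : topologicalType) (I : Type) (F : set_system I)
    (S : set T) (f : T -> U) (u : I -> T) (l : T) : Filter F ->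
  {within S, continuous f} -> S l -> (\forall i \near F, S (u i)) ->
  u @ F --> l -> f (u i) @[i --> F] --> f l.
Proof.
move=> FF /subspace_continuousP cf Sl Su ul A /(cf _ Sl) /= fA.
have := ul _ fA; rewrite /= !nbhs_simpl/= => h.
by near=> i; rewrite /=; have /= := near h i; apply=> //; near: i.
Unshelve. all: by end_near. Qed.

Lemma cvg_mx_entries (I : Type) (F : set_system I) n m (M : I -> 'M[R]_(n, m))
    (l : 'M[R]_(n, m)) : Filter F ->
  (forall i j, M t i j @[t --> F] --> l i j) -> M @ F --> l.
Proof.
move=> FF h; apply/cvg_ballP => e e0.
have : \forall t \near F, forall ij : 'I_n * 'I_m, ball (l ij.1 ij.2) e (M t ij.1 ij.2).
  by apply: filter_forall => -[i j]/=; move: e e0; apply/cvg_ballP/h.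
by apply: filterS => t ht; split => // i j; exact: (ht (i, j)).
Qed.

Lemma oo_cc t : t \in `]a, b[ -> t \in `[a, b].
Proof. by rewrite !in_itv/= => /andP[/ltW-> /ltW->]. Qed.

Lemma co_cc t : t \in `[a, b[ -> t \in `[a, b].
Proof. by rewrite !in_itv/= => /andP[-> /ltW->]. Qed.

Lemma oc_cc t : t \in `]a, b] -> t \in `[a, b].
Proof. by rewrite !in_itv/= => /andP[/ltW-> ->]. Qed.

Lemma near_oo t : t \in `]a, b[ -> \forall s \near t, s \in `]a, b[.
Proof. exact: near_in_itvoo. Qed.

Lemma PC_eq V (f g : R -> V) :
  but_finitely a b (fun t => f t = g t) -> PC a b f -> PC a b g.
Proof.
move=> fg [cf rf lf]; have nfg := fun t => but_finitely_near t fg; split.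
- apply: but_finitely_imp2 fg cf => t tab fgt cft.
  rewrite /prop_for /continuous_at -fgt.
  apply: cvg_trans cft; apply: near_eq_cvg.
  have := nfg t; rewrite near_withinE => h.
  near=> s; have [->//|st] := eqVneq s t; have /= := near h s; apply => //.
  by apply: oo_cc; near: s; exact: near_oo.
- move=> t tab; apply/cvg_ex; have /cvg_ex[l fl] := rf _ tab; exists l.
  apply: cvg_trans fl; apply: near_eq_cvg.
  have h := at_right_dnbhs (nfg t).
  near=> s; have /= := near h s; apply => //.
  by apply: oo_cc; near: s; exact: at_right_itv.
- move=> t tab; apply/cvg_ex; have /cvg_ex[l fl] := lf _ tab; exists l.
  apply: cvg_trans fl; apply: near_eq_cvg.
  have h := at_left_dnbhs (nfg t).
  near=> s; have /= := near h s; apply => //.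
  by apply: oo_cc; near: s; exact: at_left_itv.
Unshelve. all: by end_near. Qed.

Lemma PC_within V (f : R -> V) : {within `[a, b], continuous f} -> PC a b f.
Proof.
move=> cf; split.
- apply: but_finitelyT => t tab; exact: within_continuous_continuous cf tab.
- move=> t tab; apply/cvg_ex; exists (f t).
  apply: (@cvg_within_comp _ _ _ t^'+ _ f id t _ cf);
    [exact: co_cc| |exact: cvg_at_right_filter].
  by near=> s; apply: oo_cc; near: s; exact: at_right_itv.
- move=> t tab; apply/cvg_ex; exists (f t).
  apply: (@cvg_within_comp _ _ _ t^'- _ f id t _ cf);
    [exact: oc_cc| |exact: cvg_at_left_filter].
  by near=> s; apply: oo_cc; near: s; exact: at_left_itv.
Unshelve. all: by end_near. Qed.

(** A one-sided limit of [u] need not be a value of [u]; closedness of [S] keeps it where [f] is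
    continuous. *)
Lemma PC_comp V W (S : set V) (f : V -> W) (u : R -> V) : closed S ->
  {within S, continuous f} -> (forall t, t \in `[a, b] -> S (u t)) ->
  PC a b u -> PC a b (f \o u).
Proof.
move=> cS cf uS [cu ru lu]; split.
- apply: but_finitely_imp cu => t tab cut.
  apply: (@cvg_within_comp _ _ _ (nbhs t) _ f u (u t) _ cf) => //.
    exact/uS/oo_cc.
  by near=> s; apply/uS/oo_cc; near: s; exact: near_oo.
- move=> t tab; apply/cvg_ex; have /cvg_ex[l ul] := ru _ tab; exists (f l).
  have Su : \forall s \near t^'+, S (u s).
    by near=> s; apply/uS/oo_cc; near: s; exact: at_right_itv.
  by apply: (@cvg_within_comp _ _ _ t^'+ _ f u l _ cf) => //;
    exact: (@closed_cvg _ _ _ _ u S cS Su l ul).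
- move=> t tab; apply/cvg_ex; have /cvg_ex[l ul] := lu _ tab; exists (f l).
  have Su : \forall s \near t^'-, S (u s).
    by near=> s; apply/uS/oo_cc; near: s; exact: at_left_itv.
  by apply: (@cvg_within_comp _ _ _ t^'- _ f u l _ cf) => //;
    exact: (@closed_cvg _ _ _ _ u S cS Su l ul).
Unshelve. all: by end_near. Qed.

Lemma PC_compT V W (f : V -> W) (u : R -> V) :
  continuous f -> PC a b u -> PC a b (fun t => f (u t)).
Proof.
move=> cf; apply: (@PC_comp _ _ setT) => //.
exact: continuous_subspaceT.
Qed.

Lemma PC_pair V W (f : R -> V) (g : R -> W) :
  PC a b f -> PC a b g -> PC a b (fun t => (f t, g t)).
Proof.
move=> [cf rf lf] [cg rg lg]; split.
- by apply: but_finitely_imp2 cf cg => t _ cft cgt; exact: cvg_pair.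
- move=> t tab; have /cvg_ex[l fl] := rf _ tab; have /cvg_ex[k gk] := rg _ tab.
  by apply/cvg_ex; exists (l, k); exact: cvg_pair.
- move=> t tab; have /cvg_ex[l fl] := lf _ tab; have /cvg_ex[k gk] := lg _ tab.
  by apply/cvg_ex; exists (l, k); exact: cvg_pair.
Qed.

Lemma PC_mx n m (M : R -> 'M[R]_(n, m)) :
  (forall i j, PC a b (fun t => M t i j)) -> PC a b M.
Proof.
move=> h; split.
- have : but_finitely a b (fun t => forall ij : 'I_n * 'I_m,
      {for t, continuous (fun t => M t ij.1 ij.2)}).
    by apply: but_finitely_forall => -[i j]; have [] := h i j.
  apply: but_finitely_imp => t _ cM; apply: cvg_mx_entries => i j.
  exact: (cM (i, j)).
- move=> t tab; apply/cvg_ex.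
  exists (\matrix_(i, j) lim (M s i j @[s --> t^'+])).
  by apply: cvg_mx_entries => i j; rewrite mxE; have [_ + _] := h i j; exact.
- move=> t tab; apply/cvg_ex.
  exists (\matrix_(i, j) lim (M s i j @[s --> t^'-])).
  by apply: cvg_mx_entries => i j; rewrite mxE; have [_ _] := h i j; exact.
Qed.

Lemma PC_add V (f g : R -> V) :
  PC a b f -> PC a b g -> PC a b (fun t => f t + g t).
Proof.
move=> pf pg; apply: (PC_compT (f := fun p : V * V => p.1 + p.2)
  (u := fun t => (f t, g t))); last exact: PC_pair.
exact: add_continuous.
Qed.

Lemma PC_scale V (r : R -> R) (f : R -> V) :
  PC a b r -> PC a b f -> PC a b (fun t => r t *: f t).
Proof.
move=> pf pg; apply: (PC_compT (f := fun p : R^o * V => p.1 *: p.2)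
  (u := fun t => (r t, f t))); last exact: PC_pair.
exact: scale_continuous.
Qed.

Lemma PC_entry n m (M : R -> 'M[R]_(n, m)) i j :
  PC a b M -> PC a b (fun t => M t i j).
Proof. exact: (PC_compT (f := fun N : 'M[R]_(n, m) => N i j) (@coord_continuous R n m i j)). Qed.

Lemma PC_opp V (f : R -> V) : PC a b f -> PC a b (fun t => - f t).
Proof. exact: (PC_compT (f := fun v : V => - v) (@opp_continuous V)). Qed.

Lemma PC_cst V (l : V) : PC a b (fun=> l).
Proof. by apply: PC_within => t; exact: cvg_cst. Qed.

Lemma PC_sum V (I : Type) (s : seq I) (f : I -> R -> V) :
  (forall i, PC a b (f i)) -> PC a b (fun t => \sum_(i <- s) f i t).
Proof.
move=> pf; elim: s => [|i s IHs].
  by under eq_fun do rewrite big_nil; exact: PC_cst.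
by under eq_fun do rewrite big_cons; exact: PC_add.
Qed.

(* Compactness of [a, b] for a piecewise continuous function: a property of
   (t, r) that holds, for small r, at every point and along every one-sided
   limit of f holds with a single r on the whole interval. *)
Lemma PC_uniform V (f : R -> V) (Q : R -> R -> Prop) :
  PC a b f ->
  (forall t r r', 0 < r' <= r -> Q t r -> Q t r') ->
  (forall t, t \in `[a, b] -> exists2 r, 0 < r & Q t r) ->
  (forall t (l : V) (F : set_system R), Filter F -> f @ F --> l ->
     (\forall s \near F, s \in `[a, b]) -> t \in `[a, b] ->
     (F = t^'- \/ F = t^'+) ->
     exists2 r, 0 < r & \forall s \near F, Q s r) ->
  exists2 r, 0 < r & forall t, t \in `[a, b] -> Q t r.
Proof.
move=> [_ rf lf] Qmon Qpt Qlim; apply: (uniform_on_segment Qmon) => t tab.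
have [r0 r0_gt0 Q0] := Qpt _ tab.
have [r1 r1_gt0 Q1] : exists2 r, 0 < r &
    \forall s \near t^'-, s \in `[a, b] -> Q s r.
  have [ta|ta] := ltP a t.
    have tab' : t \in `]a, b] by move: tab; rewrite !in_itv/= ta => /andP[].
    have /cvg_ex[l fl] := lf _ tab'.
    have [|//||r r_gt0 Qr] := Qlim t l t^'- _ fl.
    - by near=> s; apply: oo_cc; near: s; exact: at_left_itv.
    - by left.
    by exists r => //; apply: filterS Qr.
  (* Here [t <= a]: no point of [[a, b]] lies to the left of [t], the claim is vacuous and the
     radius arbitrary. *)
  exists 1 => //; near=> s; rewrite in_itv/= => /andP[as_ _].
  suff : t < t by rewrite ltxx.
  by apply: (le_lt_trans (le_trans ta as_)); near: s; exact: nbhs_left_lt.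
have [r2 r2_gt0 Q2] : exists2 r, 0 < r &
    \forall s \near t^'+, s \in `[a, b] -> Q s r.
  have [tb|tb] := ltP t b.
    have tab' : t \in `[a, b[ by move: tab; rewrite !in_itv/= tb => /andP[->].
    have /cvg_ex[l fl] := rf _ tab'.
    have [|//||r r_gt0 Qr] := Qlim t l t^'+ _ fl.
    - by near=> s; apply: oo_cc; near: s; exact: at_right_itv.
    - by right.
    by exists r => //; apply: filterS Qr.
  exists 1 => //; near=> s; rewrite in_itv/= => /andP[_ sb].
  suff : t < t by rewrite ltxx.
  by apply: lt_le_trans (le_trans sb tb); near: s; exact: nbhs_right_gt.
exists (Num.min r0 (Num.min r1 r2)); first by rewrite !lt_min r0_gt0 r1_gt0.
have m0 : 0 < Num.min r0 (Num.min r1 r2) by rewrite !lt_min r0_gt0 r1_gt0.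
apply: nbhs_left_right.
- apply: filterS Q1 => s Qs /Qs; apply: Qmon; rewrite m0/=.
  by rewrite !ge_min lexx orbT.
- apply: filterS Q2 => s Qs /Qs; apply: Qmon; rewrite m0/=.
  by rewrite !ge_min lexx !orbT.
- move=> _; apply: Qmon Q0; rewrite m0/=.
  by rewrite !ge_min lexx.
Unshelve. all: by end_near. Qed.

Lemma PC_bounded V (f : R -> V) : PC a b f ->
  exists2 B, 0 < B & forall t, t \in `[a, b] -> `|f t| <= B.
Proof.
move=> pf.
(* The bound is encoded as the inverse of the radius, so that the property weakens as [r]
   decreases. *)
have [t r r' /andP[r'0 r'r] /le_trans|t _|t l F FF fl _ _ _|r r0 Qr] :=
    PC_uniform (Q := fun t r => `|f t| <= r^-1) pf.
- by apply; rewrite lef_pV2// posrE (lt_le_trans r'0).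
- exists ((`|f t| + 1)^-1); first by rewrite invr_gt0 ltr_wpDl.
  by rewrite invrK lerDl.
- exists ((`|l| + 1)^-1); first by rewrite invr_gt0 ltr_wpDl.
  near=> s; rewrite invrK -[f s](subrK l) addrC (le_trans (ler_normD _ _))//.
  rewrite lerD2l distrC; near: s.
  exact: ((cvgrPdist_le f l).1 fl 1 ltr01).
by exists r^-1; rewrite ?invr_gt0.
Unshelve. all: by end_near. Qed.

(** Uniform continuity of [f] along a possibly discontinuous [u]. Around a value or one-sided limit
    [l] of [u], [f] stays within [e / 2] of [f l] on a ball of radius [r]; points within [r / 2] of
    a value [u s] that is itself within [r / 2] of [l] remain in that ball. *)
Lemma PC_tube V W (S : set V) (f : V -> W) (u : R -> V) e : closed S ->
  {within S, continuous f} -> (forall t, t \in `[a, b] -> S (u t)) ->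
  PC a b u -> 0 < e ->
  exists2 r, 0 < r & forall t, t \in `[a, b] ->
    forall q, S q -> `|q - u t| <= r -> `|f q - f (u t)| <= e.
Proof.
move=> cS cf uS pu e0.
have near_f l : S l -> exists2 r, 0 < r & forall q, S q -> `|q - l| <= r ->
    `|f q - f l| <= e / 2.
  move=> Sl; move/subspace_continuousP : cf => /(_ l Sl).
  move=> /cvgrPdistC_le/(_ (e / 2)); rewrite divr_gt0// => /(_ isT).
  rewrite near_withinE/= => /nbhs_ballP[r/= r0 Hr].
  exists (r / 2); first by rewrite divr_gt0.
  move=> q Sq ql; apply: Hr => //; rewrite -ball_normE/= distrC.
  by apply: le_lt_trans ql _; rewrite ltr_pdivrMr// ltr_pMr// ltr1n.
apply: (PC_uniform pu).
- move=> t r r' /andP[_ r'r] h q Sq qr; apply: h => //; exact: le_trans r'r.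
- move=> t /uS Sut; have [r r0 Hr] := near_f _ Sut; exists r => // q Sq qr.
  by apply: le_trans (Hr _ Sq qr) _; rewrite ler_pdivrMr// ler_pMr// ler1n.
- move=> t l F FF ul Fab tab Ft.
  have PF : ProperFilter F by case: Ft => ->; exact: _.
  have Sl : S l.
    apply: (@closed_cvg _ _ _ _ u S cS _ l ul).
    by near=> s; apply: uS; near: s.
  have [r r0 Hr] := near_f _ Sl.
  have r20 : 0 < r / 2 by rewrite divr_gt0.
  exists (r / 2) => //; near=> s => q Sq qs.
  have sl : `|u s - l| <= r / 2.
    by near: s; exact: ((cvgrPdistC_le u l).1 ul _ r20).
  have Ss : S (u s) by apply: uS; near: s.
  rewrite -(subrKA (f l)) (le_trans (ler_normD _ _))// [leRHS](splitr e).
  apply: lerD.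
    apply: Hr => //; rewrite -(subrKA (u s)) (le_trans (ler_normD _ _))//.
    by rewrite [leRHS](splitr r) lerD.
  rewrite distrC; apply: Hr => //; apply: le_trans sl _.
  by rewrite ler_pdivrMr// ler_pMr// ler1n.
Unshelve. all: by end_near. Qed.

End PiecewiseContinuous.

(** * Antiderivatives off a finite set *)

Definition antiderivative {R : realType} (a b : R) (F f : R -> R) : Prop :=
  {within [set` `[a, b]], continuous F} /\
  but_finitely a b (fun t => is_derive t 1 F (f t)).

Definition primitive {R : realType} (a : R) (f : R -> R) (t : R) : R :=
  \int[lebesgue_measure]_(s in `[a, t]) f s.

Section Antiderivative.
Context {R : realType}.
Implicit Types (a b c d t : R) (f g F G : R -> R).

Lemma antiderivativeD a b F f G g : antiderivative a b F f ->
  antiderivative a b G g ->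
  antiderivative a b (fun t => F t + G t) (fun t => f t + g t).
Proof.
move=> [cF dF] [cG dG]; split; first by move=> t; apply: cvgD; [exact: cF|exact: cG].
by apply: but_finitely_imp2 dF dG => t _ ? ?; exact: is_deriveD.
Qed.

(** Integration by parts in differential form. *)
Lemma antiderivativeM a b F f G g : antiderivative a b F f ->
  antiderivative a b G g ->
  antiderivative a b (fun t => F t * G t) (fun t => F t * g t + G t * f t).
Proof.
move=> [cF dF] [cG dG]; split; first by move=> t; apply: cvgM; [exact: cF|exact: cG].
by apply: but_finitely_imp2 dF dG => t _ ? ?; exact: is_deriveM.
Qed.

Lemma antiderivative_eq a b F f g : but_finitely a b (fun t => f t = g t) ->
  antiderivative a b F f -> antiderivative a b F g.
Proof.
move=> fg [cF dF]; split => //.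
by apply: but_finitely_imp2 fg dF => t _ <-.
Qed.

Lemma antiderivative_cst a b c : antiderivative a b (fun=> c) (fun=> 0).
Proof.
split; first by move=> t; exact: cvg_cst.
by apply: but_finitelyT => t _; exact: is_derive_cst.
Qed.

Lemma antiderivativeZ a b c F f : antiderivative a b F f ->
  antiderivative a b (fun t => c * F t) (fun t => c * f t).
Proof.
move=> aF; apply: antiderivative_eq (antiderivativeM (antiderivative_cst a b c) aF).
by apply: but_finitelyT => t _; rewrite mulr0 addr0.
Qed.

Lemma antiderivativeB a b F f G g : antiderivative a b F f ->
  antiderivative a b G g ->
  antiderivative a b (fun t => F t - G t) (fun t => f t - g t).
Proof.
move=> [cF dF] [cG dG]; split; first by move=> t; apply: cvgB; [exact: cF|exact: cG].
by apply: but_finitely_imp2 dF dG => t _ ? ?; exact: is_deriveB.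
Qed.

Lemma antiderivative_sum a b (I : Type) (s : seq I) (F f : I -> R -> R) :
  (forall i, antiderivative a b (F i) (f i)) ->
  antiderivative a b (fun t => \sum_(i <- s) F i t) (fun t => \sum_(i <- s) f i t).
Proof.
move=> aF; elim: s => [|i s IHs].
  under eq_fun do rewrite big_nil; under [X in antiderivative _ _ _ X]eq_fun
    do rewrite big_nil; exact: antiderivative_cst.
under eq_fun do rewrite big_cons; under [X in antiderivative _ _ _ X]eq_fun
  do rewrite big_cons; exact: antiderivativeD.
Qed.

Lemma antiderivativeW a b c d F f : a <= c -> d <= b ->
  antiderivative a b F f -> antiderivative c d F f.
Proof.
move=> ac db [cF dF]; split; last exact: but_finitelyW dF.
apply: continuous_subspaceW cF => t /=; rewrite !in_itv/= => /andP[ct td].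
by rewrite (le_trans ac ct) (le_trans td db).
Qed.

(** Induction on the list of exceptional points: the interval is cut at each of them, continuity
    glues the pieces, and on a piece without exceptions the usual monotonicity criterion applies. *)
Lemma antiderivative_ge0_le a b F f s t : antiderivative a b F f ->
  but_finitely a b (fun t => 0 <= f t) -> a <= s -> s <= t -> t <= b ->
  F s <= F t.
Proof.
move=> aF f0 as_ st tb.
have {aF} [cF dF] := antiderivativeW as_ tb aF.
have {as_ tb} f0 := but_finitelyW as_ tb f0.
have /finite_seqP[e He] := but_finitely_and dF f0.
have : forall r, r \in `]s, t[ -> r \notin e -> is_derive r 1 F (f r) /\ 0 <= f r.
  move=> r rst re; apply: contrapT => nr.
  have : [set` e] r.
    rewrite -He; split => //; move: rst; rewrite !in_itv/=.
    by move=> /andP[/ltW-> /ltW->].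
  by rewrite /= (negPf re).
elim: e s t st cF {dF f0 He} => [|c e IHe] s t st cF H.
  have dF r : r \in `]s, t[ -> derivable F r 1 by move=> /H/(_ isT)[[]].
  apply: (ger0_derive1_le_cc dF) => //.
  - move=> r rst; have [[_ <-]] := H _ rst isT; by rewrite derive1E.
  - by rewrite in_itv/= lexx.
  - by rewrite in_itv/= lexx st.
have [cst|cst] := boolP (c \in `]s, t[); last first.
  apply: IHe => // r rst re; apply: H => //; rewrite inE negb_or re andbT.
  by apply: contraNneq cst => <-.
move: (cst); rewrite in_itv/= => /andP[sc ct].
apply: (@le_trans _ _ (F c)); apply: IHe; rewrite ?(ltW sc) ?(ltW ct)//.
- apply: continuous_subspaceW cF => r /=; rewrite !in_itv/= => /andP[-> rc].
  exact: le_trans rc (ltW ct).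
- move=> r; rewrite in_itv/= => /andP[sr rc] re; apply: H.
    by rewrite in_itv/= sr (lt_trans rc).
  by rewrite inE negb_or re lt_eqF.
- apply: continuous_subspaceW cF => r /=; rewrite !in_itv/= => /andP[cr ->].
  by rewrite (le_trans (ltW sc) cr).
- move=> r; rewrite in_itv/= => /andP[cr rt] re; apply: H.
    by rewrite in_itv/= rt (lt_trans sc).
  by rewrite inE negb_or re gt_eqF.
Qed.

(** Both [G - F] and [G + F] are nondecreasing. This plays the role of bounding the norm of an
    integral by the integral of a bound. *)
Lemma antiderivative_le a b F f G g t : antiderivative a b F f ->
  antiderivative a b G g -> but_finitely a b (fun t => `|f t| <= g t) ->
  `|F a| <= G a -> t \in `[a, b] -> `|F t| <= G t.
Proof.
move=> aF aG fg; rewrite !ler_norml => /andP[GF FG].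
rewrite in_itv/= => /andP[at_ tb]; rewrite lerNl in GF.
have h1 : G a - F a <= G t - F t.
  apply: (antiderivative_ge0_le (antiderivativeB aG aF)) => //.
  apply: but_finitely_imp fg => r _; rewrite ler_norml => /andP[_ h].
  by rewrite subr_ge0.
have h2 : G a + F a <= G t + F t.
  apply: (antiderivative_ge0_le (antiderivativeD aG aF)) => //.
  apply: but_finitely_imp fg => r _; rewrite ler_norml => /andP[h _].
  by rewrite -lerBlDl sub0r.
by apply/andP; split; lra.
Qed.

Lemma PC_integrable a b f : a < b -> PC a b f ->
  lebesgue_measure.-integrable `[a, b] (EFin \o f).
Proof.
move=> ab pf; apply: measurable_bounded_integrable => //.
- by rewrite [X in (X < _)%E]lebesgue_measure_itv/=; case: ifP => // _; rewrite -EFinB ltry.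
(* Measurability: the interval splits into an open set on which [f] is continuous and a finite set,
   made of the jumps and the end points. *)
- pose E := [set t | t \in `[a, b] /\ ~ {for t, continuous f}].
  have fE : finite_set E by case: pf.
  have fE' : finite_set (E `|` [set` [:: a; b]]).
    by rewrite finite_setU; split => //; exact: finite_seq.
  have mE : measurable (E `|` [set` [:: a; b]] : set R).
    by apply: countable_measurable => //; exact: finite_set_countable.
  have oU : open (`]a, b[ `\` (E `|` [set` [:: a; b]]) : set R).
    apply: openI; first exact: interval_open.
    apply: closed_openC; apply: (@accessible_finite_set_closed R).1 => //.
    exact: hausdorff_accessible.
  apply: (measurable_funS (E := (`]a, b[ `\` (E `|` [set` [:: a; b]])) `|`
       (E `|` [set` [:: a; b]]))).
  + by apply: measurableU => //; exact: measurableD.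
  + move=> t /= tab; case: (pselect ((E `|` [set` [:: a; b]]) t)) => Et; first by right.
    left; split => //; move: tab Et; rewrite !in_itv/= !inE => /andP[at_ tb] h.
    by rewrite !lt_neqAle at_ tb !andbT eq_sym; apply/andP; split; apply/eqP => te;
      apply: h; right; rewrite te eqxx ?orbT.
  + apply/measurable_funU => //; first exact: measurableD.
    split.
      apply: measurable_realfun.open_continuous_measurable_fun => // t.
      rewrite inE => -[/= tab nE]; apply: contrapT => nc; apply: nE; left.
      by split => //; exact: oo_cc.
    move=> _ Y mY; apply: countable_measurable => //.
    by apply: finite_set_countable; apply: sub_finite_set fE' => t [].
- have [B B0 HB] := PC_bounded pf.
  exists B; split; first exact: num_real.
  by move=> M BM t /= tab; exact: le_trans (HB _ tab) (ltW BM).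
Qed.

Lemma primitiveP a b f : a < b -> PC a b f ->
  antiderivative a b (primitive a f) f.
Proof.
move=> ab pf; have intf := PC_integrable ab pf; split.
  exact: (parameterized_integral_continuous (ltW ab) intf).
have [cf _ _] := pf; apply: but_finitely_imp cf => t; rewrite in_itv/=.
move=> /andP[at_ tb] cft.
have [//|d1 d2] := continuous_FTC1 (a := BLeft a) tb intf _ cft.
by apply: DeriveDef; [exact: d1|rewrite -derive1E; exact: d2].
Qed.

Lemma primitive0 a f : primitive a f a = 0.
Proof. by rewrite /primitive set_itv1 Rintegral_set1. Qed.

Lemma antiderivative_id a b : antiderivative a b id (fun=> 1).
Proof.
split; first by apply: continuous_subspaceT => t; exact: cvg_id.
by apply: but_finitelyT => t _; exact: is_derive_id.
Qed.

(** A mean value inequality that tolerates finitely many exceptions: [F r - c * (r - s) - F s] is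
    compared with [e * (r - s)]. *)
Lemma antiderivative_mean F f (c e : R) s t : s <= t -> antiderivative s t F f ->
  but_finitely s t (fun r => `|f r - c| <= e) ->
  `|F t - F s - c * (t - s)| <= e * (t - s).
Proof.
move=> st aF fe.
have lin (k l : R) : antiderivative s t (fun r => k * (r - s) + l) (fun=> k).
  have := antiderivativeD (antiderivativeZ k (antiderivativeB
    (antiderivative_id s t) (antiderivative_cst s t s))) (antiderivative_cst s t l).
  by apply: antiderivative_eq; apply: but_finitelyT => r _; rewrite subr0 mulr1 addr0.
have := antiderivative_le (antiderivativeB aF (lin c (F s))) (lin e 0) fe _ _ => /(_ t).
rewrite !subrr !mulr0 !add0r subrr normr0 lexx in_itv/= st lexx => /(_ isT isT).
by rewrite addr0 opprD addrA addrAC.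
Qed.

End Antiderivative.

(** * One-sided derivatives *)

Section OneSidedDerivative.
Context {R : realType}.
Variables a b : R.
Hypothesis ab : a < b.
Implicit Types (V W : normedModType R) (t : R).

Local Notation dq_filter t :=
  (within [set h : R | [set` `[a, b]] (t + h *: 1)] 0^').

Definition has_D1 V (f : R -> V) t (l : V) : Prop :=
  (fun h : R => h^-1 *: (f (t + h *: 1) - f t)) @ dq_filter t --> l.

(** Since [a < b], every point can be approached from at least one side: from the right if [t < b],
    from the left at [b]. Properness makes the relative derivative unique. *)
Lemma dq_filter_proper t : t \in `[a, b] -> ProperFilter (dq_filter t).
Proof.
move=> tab; apply: Build_ProperFilter; rewrite /within /= => nA.
have [tb|tb] := ltP t b.
  have {}nA := at_right_dnbhs nA; near ((0:R)^'+) => h.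
  have /= := near nA h; apply => //.
  move: tab; rewrite /GRing.scale/= mulr1 !in_itv/= => /andP[at_ _].
  rewrite (le_trans at_)/= ?lerDl// -lerBrDl.
  by near: h; apply: nbhs_right_le; rewrite subr_gt0.
have {}nA := at_left_dnbhs nA; near ((0:R)^'-) => h.
have /= := near nA h; apply => //.
move: tab; rewrite /GRing.scale/= mulr1 !in_itv/= => /andP[_ tb'].
apply/andP; split; last by rewrite (@le_trans _ _ t) ?gerDl.
rewrite -lerBlDl.
by near: h; apply: nbhs_left_ge; rewrite subr_lt0; exact: lt_le_trans tb.
Unshelve. all: by end_near. Qed.

Lemma has_D1P V (f : R -> V) t l : t \in `[a, b] -> has_D1 f t l ->
  derivable_on [set` `[a, b]] f t 1 /\ D1 a b f t = l.
Proof.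
move=> /dq_filter_proper PF fl; split; first by apply/cvg_ex; exists l.
exact: (@cvg_lim _ (@norm_hausdorff R V) _ _ PF _ _ fl).
Qed.

Lemma derivable_on_has_D1 V (f : R -> V) t :
  derivable_on [set` `[a, b]] f t 1 -> has_D1 f t (D1 a b f t).
Proof. by []. Qed.

Lemma has_D1_eq V (f g : R -> V) t l : (forall s, s \in `[a, b] -> f s = g s) ->
  t \in `[a, b] -> has_D1 f t l -> has_D1 g t l.
Proof.
move=> fg tab; apply: cvg_trans; apply: near_eq_cvg.
by rewrite near_withinE; apply: filterE => h /= th; rewrite !fg.
Qed.

Lemma D1_eq V (f g : R -> V) t : (forall s, s \in `[a, b] -> f s = g s) ->
  t \in `[a, b] -> D1 a b f t = D1 a b g t.
Proof.
move=> fg tab; rewrite /D1 /derive_on; congr (lim _).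
by apply/seteqP; split; apply: near_eq_cvg; rewrite near_withinE;
  apply: filterE => h /= th; rewrite !fg.
Qed.

Lemma derivable_on_eq V (f g : R -> V) t :
  (forall s, s \in `[a, b] -> f s = g s) -> t \in `[a, b] ->
  derivable_on [set` `[a, b]] f t 1 -> derivable_on [set` `[a, b]] g t 1.
Proof.
move=> fg tab /derivable_on_has_D1/(has_D1_eq fg tab)/has_D1P.
by move=> /(_ tab)[].
Qed.

Lemma dq_filter_interior t : t \in `]a, b[ -> dq_filter t = 0^'.
Proof.
rewrite in_itv/= => /andP[at_ tb]; apply/seteqP; split => A.
  rewrite /within/= => hA; near=> h.
  have /= := near hA h; apply => //.
  rewrite /GRing.scale/= mulr1 in_itv/=.
  have : `|h| <= t - a by near: h; apply: dnbhs0_le; rewrite subr_gt0.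
  have : `|h| <= b - t by near: h; apply: dnbhs0_le; rewrite subr_gt0.
  rewrite !ler_norml => /andP[_ h1] /andP[h2 _].
  by apply/andP; split; lra.
by rewrite /within/=; apply: filterS.
Unshelve. all: by end_near. Qed.

Lemma has_D1_interior V (f : R -> V) t l : t \in `]a, b[ ->
  has_D1 f t l <-> is_derive t 1 f l.
Proof.
move=> tab; rewrite /has_D1 dq_filter_interior//.
have -> : (fun h : R => h^-1 *: (f (t + h *: 1) - f t)) =
    (fun h => h^-1 *: ((f \o shift t) (h *: 1) - f t)).
  by apply/funext => h /=; rewrite (addrC t).
split=> [fl|[df <-]]; last exact: df.
apply: DeriveDef; first by apply/cvg_ex; exists l.
exact: (@cvg_lim _ (@norm_hausdorff R V) _ _ _ _ _ fl).
Qed.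

Lemma has_D1_comb V (f g : R -> V) t l k (c : R) :
  has_D1 f t l -> has_D1 g t k -> has_D1 (fun t => f t + c *: g t) t (l + c *: k).
Proof.
move=> fl gk; rewrite /has_D1.
under eq_fun => h.
  rewrite opprD addrACA -scalerBr scalerDr (scalerA _ c) mulrC -scalerA; over.
by apply: cvgD => //; apply: cvgZr.
Qed.

Lemma has_D1_mx n m (M : R -> 'M[R]_(n, m)) t (N : 'M[R]_(n, m)) :
  (forall i j, has_D1 (fun t => M t i j) t (N i j)) -> has_D1 M t N.
Proof.
move=> h; apply: cvg_mx_entries => i j; have := h i j; rewrite /has_D1.
by under [X in _ -> X @ _ --> _]eq_fun do rewrite !mxE.
Qed.

(** Where [f] is continuous relative to [[a, b]], the mean value inequality on the segment between
    [t] and [t + h] gives the derivative of [F], even at an end point or an exceptional point. This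
    recovers the everywhere defined derivatives that [Ck] demands. *)
Lemma has_D1_antiderivative (F f : R -> R) t : antiderivative a b F f ->
  t \in `[a, b] -> f s @[s --> within [set` `[a, b]] (nbhs t)] --> f t ->
  has_D1 F t (f t).
Proof.
move=> aF tab cf; apply/cvgrPdistC_le => e e0.
have [r/= r0 Hr] : exists2 r : R, 0 < r &
    forall s, ball t r s -> s \in `[a, b] -> `|f s - f t| <= e.
  have /nbhs_ballP[r/= r0 Hr] := cf _ (nbhsx_ballx (f t) e e0).
  by exists r => // s /Hr h /h; rewrite /ball/= distrC => /ltW.
rewrite near_withinE.
near=> h => hab; rewrite /= /GRing.scale/= mulr1 in hab *.
have h0 : h != 0 by near: h; exact: nbhs_dnbhs_neq.
have hr : `|h| < r by near: h; apply: dnbhs0_lt.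
have -> : h^-1 * (F (t + h) - F t) - f t = h^-1 * (F (t + h) - F t - f t * (t + h - t)).
  by rewrite [t + h]addrC addrK; field.
rewrite normrM normfV ler_pdivrMl ?normr_gt0// [leRHS]mulrC.
have [hp|hn] := ltP 0 h.
- have th : t <= t + h by rewrite lerDl ltW.
  have -> : `|h| = t + h - t by rewrite (gtr0_norm hp); ring.
  apply: antiderivative_mean => //.
    by apply: antiderivativeW aF; move: tab hab; rewrite !in_itv/= => /andP[? ?] /andP[].
  apply: but_finitelyT => s; rewrite in_itv/= => /andP[ts sth].
  apply: Hr.
    rewrite /ball/= distrC gtr0_norm ?subr_gt0// ltrBlDl (lt_trans sth)//.
    by rewrite ltrD2l; apply: le_lt_trans hr; rewrite ler_norm.
  move: tab hab; rewrite /= !in_itv/= => /andP[at_ _] /andP[_ thb].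
  by rewrite (le_trans at_ (ltW ts)) (le_trans (ltW sth) thb).
- have th : t + h <= t by rewrite gerDl.
  have -> : F (t + h) - F t - f t * (t + h - t) =
      - (F t - F (t + h) - f t * (t - (t + h))) by ring.
  have -> : `|h| = t - (t + h) by rewrite (ler0_norm hn); ring.
  rewrite normrN; apply: antiderivative_mean => //.
    by apply: antiderivativeW aF; move: tab hab; rewrite !in_itv/= => /andP[? ?] /andP[].
  apply: but_finitelyT => s; rewrite in_itv/= => /andP[ths st].
  apply: Hr.
    rewrite /ball/= gtr0_norm ?subr_gt0// ltrBlDr -ltrBlDl.
    apply: le_lt_trans ths; rewrite lerD2l lerNl.
    by rewrite (le_trans _ (ltW hr))// -normrN ler_norm.
  move: tab hab; rewrite /= !in_itv/= => /andP[_ tb] /andP[ath _].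
  by rewrite (le_trans ath (ltW ths)) (le_trans (ltW st) tb).
Unshelve. all: by end_near. Qed.

Lemma antiderivative_D1 (F f : R -> R) : antiderivative a b F f ->
  but_finitely a b (fun t => derivable_on [set` `[a, b]] F t 1 /\ D1 a b F t = f t).
Proof.
move=> [_]; apply: but_finitely_imp => t tab dF.
by apply: has_D1P; [exact: oo_cc|apply/has_D1_interior].
Qed.

Lemma PC1_antiderivative (F : R -> R) : PC1 a b F -> antiderivative a b F (D1 a b F).
Proof.
move=> [cF dF _]; split=> //; apply: but_finitely_imp dF => t tab /derivable_on_has_D1.
by move/(has_D1_interior _ _ tab).
Qed.

Lemma PC1_antiderivatives n m (F f : R -> 'M[R]_(n, m)) :
  (forall i j, antiderivative a b (fun t => F t i j) (fun t => f t i j)) ->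
  PC a b f -> PC1 a b F /\ but_finitely a b (fun t => D1 a b F t = f t).
Proof.
move=> aF pf.
have DF : but_finitely a b (fun t =>
    derivable_on [set` `[a, b]] F t 1 /\ D1 a b F t = f t).
  apply: (@but_finitely_imp _ _ _ (fun t => forall ij : 'I_n * 'I_m,
    is_derive t 1 (fun t => F t ij.1 ij.2) (f t ij.1 ij.2))) => [t tab dF|].
    apply: has_D1P; first exact: oo_cc.
    by apply: has_D1_mx => i j; apply/has_D1_interior => //; exact: (dF (i, j)).
  by apply: but_finitely_forall => -[i j]; have [] := aF i j.
have DF2 : but_finitely a b (fun t => D1 a b F t = f t).
  by apply: but_finitely_imp DF => t _ [].
split; last exact: DF2.
split.
- apply/subspace_continuousP => t tab.
  apply: (@cvg_mx_entries R R (within [set` `[a, b]] (nbhs t)) n m F (F t) _).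
  move=> i j.
  have [/subspace_continuousP cF _] := aF i j; exact: cF.
- by apply: but_finitely_imp DF => t _ [].
- by apply: PC_eq pf; apply: but_finitely_imp DF2 => t _ ->.
Qed.

Lemma PC1_eq V (f g : R -> V) : (forall s, s \in `[a, b] -> f s = g s) ->
  PC1 a b f -> PC1 a b g.
Proof.
move=> fg [cf df pf]; split.
- by apply: subspace_eq_continuous cf => t; rewrite inE => /fg.
- apply: but_finitely_imp df => t tab; apply: derivable_on_eq => //; exact: oo_cc.
- by apply: PC_eq pf; apply: but_finitelyT => t tab; apply: D1_eq => //; exact: oo_cc.
Qed.

Lemma PC1_comb V (f g : R -> V) c : PC1 a b f -> PC1 a b g ->
  PC1 a b (fun t => f t + c *: g t) /\
  but_finitely a b (fun t =>
    D1 a b (fun t => f t + c *: g t) t = D1 a b f t + c *: D1 a b g t).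
Proof.
move=> [cf df pf] [cg dg pg].
have D : but_finitely a b (fun t =>
    derivable_on [set` `[a, b]] (fun t => f t + c *: g t) t 1 /\
    D1 a b (fun t => f t + c *: g t) t = D1 a b f t + c *: D1 a b g t).
  apply: but_finitely_imp2 df dg => t tab /derivable_on_has_D1 dft /derivable_on_has_D1 dgt.
  by apply: has_D1P; [exact: oo_cc|exact: has_D1_comb].
have D' : but_finitely a b (fun t =>
    D1 a b (fun t => f t + c *: g t) t = D1 a b f t + c *: D1 a b g t).
  by apply: but_finitely_imp D => t _ [].
split; last exact: D'.
split.
- by move=> t; apply: cvgD; [exact: cf|apply: cvgZr; exact: cg].
- by apply: but_finitely_imp D => t _ [].
- apply: (@PC_eq _ _ _ _ (fun t => D1 a b f t + c *: D1 a b g t)).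
    by apply: but_finitely_imp D' => t _ ->.
  by apply: PC_add => //; apply: PC_scale => //; exact: PC_cst.
Qed.

Lemma Ck_comb V k (f g : R -> V) c : Ck a b k f -> Ck a b k g ->
  Ck a b k (fun t => f t + c *: g t) /\
  forall j t, (j <= k)%N -> t \in `[a, b] ->
    Dn a b j (fun t => f t + c *: g t) t = Dn a b j f t + c *: Dn a b j g t.
Proof.
move=> [df cf] [dg cg]; set h := fun t => _.
have D j t : (j <= k)%N -> t \in `[a, b] ->
    Dn a b j h t = Dn a b j f t + c *: Dn a b j g t.
  elim: j t => [//|j IHj] t jk tab; rewrite /Dn !iterS.
  rewrite (D1_eq (g := fun t => Dn a b j f t + c *: Dn a b j g t))//; last first.
    by move=> s sab; apply: IHj => //; exact: ltnW.
  apply: (has_D1P tab _).2.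
  by apply: has_D1_comb; apply: derivable_on_has_D1; [exact: df|exact: dg].
split; last exact: D.
split.
  move=> j t jk tab.
  apply: (@derivable_on_eq _ (fun t => Dn a b j f t + c *: Dn a b j g t)) => //.
    by move=> s sab; rewrite D//; exact: ltnW.
  apply: (has_D1P tab _).1.
  by apply: has_D1_comb; apply: derivable_on_has_D1; [exact: df|exact: dg].
move=> j jk; apply: (@subspace_eq_continuous _ _ _
    (fun t => Dn a b j f t + c *: Dn a b j g t)).
  by move=> t; rewrite inE => tab; symmetry; exact: D.
by move=> t; apply: cvgD; [exact: cf|apply: cvgZr; exact: cg].
Qed.

End OneSidedDerivative.

(** * Picard iteration *)

Section Picard.
Context {R : realType}.
Implicit Types (a b : R).

Lemma exp2_small (B e : R) : 0 < e -> exists k, B * 2 ^- k <= e.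
Proof.
move=> e0; have [B0|B0] := leP B 0.
  by exists 0%N; rewrite expr0 invr1 mulr1 (le_trans B0) ?ltW.
have Be : 0 <= B / e by rewrite divr_ge0// ltW.
exists (Num.bound (B / e)); rewrite ler_pdivrMr ?exprn_gt0//.
rewrite mulrC -ler_pdivrMr// (le_trans (ltW (archi_boundP Be)))//.
by rewrite -natrX ler_nat ltnW// ltn_expl.
Qed.

(** With [r k] the tail of the geometric series from index [k], the intervals from [u k - r k] to
    [u k + r k] are nested; the limit is the supremum of their left end points. *)
Lemma geometric_limit (u : nat -> R) (B : R) :
  (forall k, `|u k.+1 - u k| <= B * 2 ^- k) ->
  exists l, forall k, `|u k - l| <= B * 2 * 2 ^- k.
Proof.
move=> uB; pose r k := B * 2 * 2 ^- k.
have rS k : r k.+1 = r k - B * 2 ^- k.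
  by rewrite /r exprS invfM; field; rewrite expf_neq0.
have up k j : u (k + j)%N + r (k + j)%N <= u k + r k.
  elim: j => [|j IHj]; first by rewrite addn0.
  apply: le_trans IHj; rewrite addnS rS.
  by have := uB (k + j)%N; rewrite ler_norml => /andP[_]; lra.
have dn k j : u k - r k <= u (k + j)%N - r (k + j)%N.
  elim: j => [|j IHj]; first by rewrite addn0.
  apply: (le_trans IHj); rewrite addnS rS.
  by have := uB (k + j)%N; rewrite ler_norml => /andP[+ _]; lra.
have r0 k : 0 <= r k.
  rewrite /r -mulrA; apply: mulr_ge0; last by rewrite mulr_ge0// invr_ge0 exprn_ge0.
  by have := uB 0%N; rewrite expr0 invr1 mulr1; exact: le_trans.
have cross j k : u j - r j <= u k + r k.
  have := dn j k; have := up k j; rewrite addnC; have := r0 (j + k)%N; lra.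
pose S := range (fun k => u k - r k).
have bS k : ubound S (u k + r k) by move=> _ [j _ <-].
have S0 : S !=set0 by exists (u 0%N - r 0%N), 0%N.
exists (sup S) => k; rewrite -/(r k) distrC ler_distl; apply/andP; split.
  by apply: ub_le_sup; [exists (u 0%N + r 0%N); exact: bS|exists k].
by apply: ge_sup => //; exact: bS.
Qed.

(** The bound on the solution is kept linear in [C]: for the perturbed equation [C] is a multiple of
    [|s|], and this is what makes the solution [O(s)]. *)
Lemma picard a b (f : R -> R -> R) (K C : R) : a < b -> 0 < K -> 0 <= C ->
  (forall w, {within [set` `[a, b]], continuous w} -> PC a b (fun t => f t (w t))) ->
  (forall t u v, t \in `[a, b] -> `|f t u - f t v| <= K * `|u - v|) ->
  (forall t, t \in `[a, b] -> `|f t 0| <= C) ->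
  exists w, [/\ antiderivative a b w (fun t => f t (w t)), w a = 0 &
    forall t, t \in `[a, b] -> `|w t| <= C / K * expR (2 * K * (b - a))].
Proof.
move=> ab K0 C0 fPC fK fC.
pose E t := expR (2 * K * (t - a)).
have aE : antiderivative a b E (fun t => 2 * K * E t).
  split.
    apply: continuous_subspaceT => t; apply: continuous_comp; last exact: continuous_expR.
    apply: continuousM; first exact: cvg_cst.
    by apply: cvgB; [exact: cvg_id|exact: cvg_cst].
  apply: but_finitelyT => t _.
  have : is_derive t 1 (fun t => 2 * K * (t - a)) (2 * K).
    have := is_deriveM (is_derive_cst (2 * K) t 1)
      (is_deriveB (is_derive_id t 1) (is_derive_cst a t 1)).
    move=> h; apply: (is_derive_eq h).
    by rewrite subr0 scaler0 addr0 /GRing.scale/= mulr1.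
  move/(is_derive1_comp (is_derive_expR _)) => h; apply: (is_derive_eq h).
  by rewrite mulrC.
have E0 t : 0 < E t by exact: expR_gt0.
have Ea : E a = 1 by rewrite /E subrr mulr0 expR0.
have E1 t : t \in `[a, b] -> 1 <= E t.
  rewrite in_itv/= => /andP[at_ _]; rewrite -Ea /E ler_expR subrr mulr0.
  by rewrite !mulr_ge0 ?subr_ge0// ltW.
have Eb t : t \in `[a, b] -> E t <= E b.
  rewrite in_itv/= => /andP[_ tb]; rewrite /E ler_expR ler_pM2l ?mulr_gt0//.
  by rewrite lerD2r.
(* Chosen so that [B * E] has derivative [C * E >= C], which dominates the first iterate. *)
pose B := C / (2 * K).
have B0 : 0 <= B by rewrite divr_ge0// mulr_ge0// ltW.
have BE0 k t : 0 <= B * 2 ^- k * E t.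
  apply: mulr_ge0; last exact: ltW.
  by apply: mulr_ge0 => //; rewrite invr_ge0 exprn_ge0.
pose u := fix u k := if k is k'.+1 then primitive a (fun t => f t (u k' t)) else fun=> 0.
have cu k : {within [set` `[a, b]], continuous (u k)}.
  elim: k => [|k IHk]; first by move=> t; exact: cvg_cst.
  by have [] := primitiveP ab (fPC _ IHk).
have au k : antiderivative a b (u k.+1) (fun t => f t (u k t)).
  exact: primitiveP ab (fPC _ (cu k)).
have ua k : u k a = 0 by case: k => [//|k]; exact: primitive0.
(* The weight E absorbs the Lipschitz constant: integrating K E gives E / 2,
   so each iteration halves the bound on the whole interval. *)
have uB k t : t \in `[a, b] -> `|u k.+1 t - u k t| <= B * E t * 2 ^- k.
  elim: k t => [|k IHk] t tab.
    rewrite subr0 expr0 invr1 mulr1.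
    apply: (antiderivative_le (au 0%N) (antiderivativeZ B aE)) tab.
      apply: but_finitelyT => s /oo_cc sab; apply: (le_trans (fC _ sab)).
      rewrite /B [leRHS](_ : _ = C * E s); last by field; rewrite gt_eqF.
      by rewrite ler_peMr// E1.
    by rewrite ua normr0 mulr_ge0// ltW.
  rewrite mulrAC.
  apply: (antiderivative_le (antiderivativeB (au k.+1) (au k))
    (antiderivativeZ (B * 2 ^- k.+1) aE)) tab.
    apply: but_finitelyT => s /oo_cc sab; apply: (le_trans (fK _ _ _ sab)).
    apply: le_trans (ler_wpM2l (ltW K0) (IHk _ sab)) _.
    by rewrite exprS invfM le_eqVlt; apply/orP; left; apply/eqP; field; rewrite expf_neq0.
  by rewrite !ua subrr normr0.
have : forall t, exists l, t \in `[a, b] -> forall k,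
    `|u k t - l| <= B * E t * 2 * 2 ^- k.
  move=> t; case: (boolP (t \in `[a, b])) => tab; last by exists 0.
  by have [|l Hl] := @geometric_limit (u ^~ t) (B * E t);
    [move=> k; exact: uB|exists l].
move=> /choice[w Hw].
have unif e : 0 < e -> exists k, forall t, t \in `[a, b] -> `|u k t - w t| <= e.
  move=> e0; have [k Hk] := exp2_small (B * E b * 2) e0; exists k => t tab.
  apply: le_trans (Hw _ tab k) (le_trans _ Hk).
  by rewrite ler_pM2r ?invr_gt0 ?exprn_gt0// ler_pM2r// ler_wpM2l// Eb.
have cw : {within [set` `[a, b]], continuous w}.
  apply/subspace_continuousP => t tab.
  apply/cvgrPdist_le => e e0; have e3 : 0 < e / 3 by rewrite divr_gt0.
  have [k Hk] := unif _ e3.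
  have /subspace_continuousP/(_ t tab) cuk := cu k.
  have Hu : \forall s \near t, s \in `[a, b] -> `|u k t - u k s| < e / 3.
    exact: cuk _ (nbhsx_ballx (u k t) _ e3).
  rewrite near_withinE; apply: filterS Hu => s Hs sab.
  rewrite [leRHS](_ : e = e / 3 + e / 3 + e / 3); last by field.
  rewrite (_ : w t - w s = - (u k t - w t) + (u k t - u k s) + (u k s - w s)); last by ring.
  apply: le_trans (ler_normD _ _) _; apply: lerD; last exact: Hk.
  apply: le_trans (ler_normD _ _) _; rewrite normrN; apply: lerD; first exact: Hk.
  exact/ltW/Hs.
(* So far [w] is only a uniform limit of the iterates. The primitive [v] solves the equation once
   [v = w] on [[a, b]], which holds because [v - u (k+1)] is obtained by integrating the effect of
   the error [w - u k]. *)
pose v := primitive a (fun t => f t (w t)).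
have av : antiderivative a b v (fun t => f t (w t)) by exact: primitiveP ab (fPC _ cw).
have vw t : t \in `[a, b] -> v t = w t.
  move=> tab; apply/eqP; rewrite -subr_eq0 -normr_le0; apply/ler_addgt0Pr => e e0.
  rewrite add0r; have [k Hk] := exp2_small (B * E t * 2) e0.
  apply: le_trans Hk.
  have h1 : `|v t - u k.+1 t| <= B * 2 ^- k * E t.
    apply: (antiderivative_le (antiderivativeB av (au k))
      (antiderivativeZ (B * 2 ^- k) aE)) tab.
      apply: but_finitelyT => s /oo_cc sab; apply: (le_trans (fK _ _ _ sab)).
      rewrite distrC; apply: le_trans (ler_wpM2l (ltW K0) (Hw _ sab k)) _.
      by rewrite le_eqVlt; apply/orP; left; apply/eqP; ring.
    by rewrite ua /v primitive0 subrr normr0.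
  have := Hw _ tab k.+1; rewrite exprS invfM => h2.
  rewrite -(subrKA (u k.+1 t)); apply: (le_trans (ler_normD _ _)).
  apply: (le_trans (lerD h1 h2)).
  by rewrite le_eqVlt; apply/orP; left; apply/eqP; field; rewrite expf_neq0.
exists v; split.
- apply: antiderivative_eq av; apply: but_finitelyT => t /oo_cc tab.
  by rewrite vw.
- exact: primitive0.
(* The case [k = 0] of the error estimate: as [u 0 = 0], it bounds [w] itself by [2 * B * E t]. *)
- move=> t tab; rewrite vw//; have := Hw _ tab 0%N.
  rewrite sub0r normrN expr0 invr1 mulr1 => /le_trans; apply.
  rewrite [leLHS](_ : _ = C / K * E t); last by rewrite /B; field; rewrite gt_eqF.
  by rewrite ler_wpM2l ?Eb// divr_ge0// ltW.
Qed.

End Picard.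

(** * Increments of a function with continuous directional derivatives *)

Section Increments.
Context {R : realType}.

(** The mean value theorem for [s |-> f (p + s *: v)], applied on the side of 0 where [c] lies. *)
Lemma line_increment (V : normedModType R) (f : V -> R) (p v : V) (c l e : R) :
  (forall s, derivable f (p + s *: v) v) ->
  (forall s, `|s| <= `|c| -> `|'D_v f (p + s *: v) - l| <= e) ->
  `|f (p + c *: v) - f p - c * l| <= e * `|c|.
Proof.
move=> df He; pose phi (s : R) := f (p + s *: v).
have dphi (s : R) : is_derive s 1 phi ('D_v f (p + s *: v)).
  have E : (fun h : R => h^-1 *: ((phi \o shift s) (h *: 1) - phi s)) =
      (fun h => h^-1 *: ((f \o shift (p + s *: v)) (h *: v) - f (p + s *: v))).
    apply/funext => h /=; rewrite /phi; congr (_ *: (f _ - _)).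
    by rewrite scalerDl /GRing.scale/= mulr1 addrCA.
  have := derivableP (df s); rewrite /derivable /derive => -[d1 d2].
  by apply: DeriveDef; rewrite ?/derivable ?/derive E.
have cphi A : {within A, continuous phi}.
  apply: continuous_subspaceT => s; have [ds _] := dphi s.
  by apply: differentiable_continuous; exact/derivable1_diffP.
have [s sc E] : exists2 s, `|s| <= `|c| & phi c - phi 0 = 'D_v f (p + s *: v) * c.
  have [c0|c0] := leP 0 c.
    have [s] := MVT_segment c0 (fun x _ => dphi x) (cphi _).
    rewrite in_itv/= subr0 => /andP[s0 sc] E; exists s => //.
    by rewrite !ger0_norm.
  have [s] := MVT_segment (ltW c0) (fun x _ => dphi x) (cphi _).
  rewrite in_itv/= sub0r => /andP[cs s0] E; exists s.
    by rewrite !ler0_norm ?(ltW c0)// lerN2.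
  by rewrite -opprB E mulrN opprK.
have -> : f (p + c *: v) - f p - c * l = ('D_v f (p + s *: v) - l) * c.
  have -> : f p = phi 0 by rewrite /phi scale0r addr0.
  by rewrite -/(phi c) E; ring.
by rewrite normrM ler_wpM2r// He.
Qed.

(** From [p] to the displaced point one direction is followed at a time, and every point met on the
    way is within the sum of the [|c i|] of [p]. The first-order expansion thus comes from
    directional derivatives alone. *)
Lemma sum_increment (V : normedModType R) (S : set V) (f : V -> R) (I : eqType)
    (s : seq I) (v : I -> V) (c l : I -> R) (p : V) (e : R) :
  S p -> (forall i q k, S q -> S (q + k *: v i)) ->
  (forall i q, S q -> derivable f q (v i)) -> (forall i, `|v i| <= 1) ->
  (forall i q, i \in s -> S q -> `|q - p| <= \sum_(i <- s) `|c i| ->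
     `|'D_(v i) f q - l i| <= e) ->
  `|f (p + \sum_(i <- s) c i *: v i) - f p - \sum_(i <- s) c i * l i| <=
    e * \sum_(i <- s) `|c i|.
Proof.
move=> Sp Sv df v1; elim: s p Sp => [|i s IHs] p Sp He.
  by rewrite !big_nil addr0 !subrr normr0 mulr0.
rewrite !big_cons addrA.
set p' := p + c i *: v i; have Sp' : S p' by exact: Sv.
have np' : `|p' - p| <= `|c i|.
  by rewrite /p' addrC addKr normrZ ler_piMr.
have h1 : `|f p' - f p - c i * l i| <= e * `|c i|.
  apply: line_increment => [r|r rc]; first exact/df/Sv.
  apply: He; [exact: mem_head|exact: Sv|].
  rewrite addrC addKr normrZ big_cons; apply: le_trans (ler_piMr _ (v1 i)) _ => //.
  by rewrite (le_trans rc)// lerDl sumr_ge0.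
have h2 := IHs p' Sp' _.
rewrite mulrDr (_ : _ - _ - _ = (f p' - f p - c i * l i) +
  (f (p' + \sum_(j <- s) c j *: v j) - f p' - \sum_(j <- s) c j * l j)); last by ring.
apply: le_trans (ler_normD _ _) _; apply: lerD h1 _; apply: h2 => j q js Sq qp.
apply: He => //; first by rewrite inE js orbT.
rewrite big_cons [leRHS]addrC; apply: le_trans (ler_distD p' q p) _.
exact: lerD.
Qed.

End Increments.

(** * Coordinate directions in the argument space of [L] *)

Lemma mx_norm_le {R : realType} n m (M : 'M[R]_(n, m)) (e : R) : 0 <= e ->
  (forall i j, `|M i j| <= e) -> `|M| <= e.
Proof.
by move=> e0 h; rewrite /Num.norm/= mx_normrE; apply/bigmax_leP; split => // -[i j] _.
Qed.

Section Directions.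
Context {R : realType} {n m : nat}.
Variables a b : R.
Notation Larg := (@Larg R n m).
Notation Ldom := (@Ldom R n m a b).

(** [None] is the direction of [z]. The time direction is left out: variations take place at fixed
    [t]. *)
Definition dir (i : option ('I_n.+1 * 'I_m)) : Larg :=
  if i is Some jk then (0, delta_mx jk.1 jk.2, 0) else (0, 0, 1).

Lemma dir_norm i : `|dir i| <= 1.
Proof.
case: i => [[j k]|]; rewrite /dir !prod_normE/= !normr0.
  rewrite !ge_max ler01 andbT /=; apply: mx_norm_le => // i l.
  by rewrite mxE normr_nat lern1 leq_b1.
by rewrite normr1 !ge_max ler01 lexx.
Qed.

Lemma Ldom_dir i (q : Larg) (k : R) : Ldom q -> Ldom (q + k *: dir i).
Proof.
by rewrite /Defs.Ldom /= => h; case: i => [[? ?]|]; rewrite /= scaler0 addr0.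
Qed.

Lemma Ldom_closed : closed Ldom.
Proof.
rewrite (_ : Ldom = (fun p : Larg => p.1.1) @^-1` [set` `[a, b]])//.
apply: closed_comp; last exact: itv_closed.
move=> p _; apply: (@continuous_comp _ _ _ fst fst); exact: cvg_fst.
Qed.

(** A displacement along [dir i] does not change [t], so it never leaves [Ldom] and the relative
    filter is the full one. *)
Lemma derivable_on_Ldom (L : Larg -> R) i q : Ldom q ->
  (derivable_on Ldom L q (dir i) -> derivable L q (dir i)) /\
  derive_on Ldom L q (dir i) = 'D_(dir i) L q.
Proof.
move=> Lq; rewrite /derivable_on /derive_on /derivable /derive.
have -> : [set h | Ldom (q + h *: dir i)] = setT.
  by apply/seteqP; split => // h _; exact: Ldom_dir.
have -> : within [set: R] 0^' = 0^'.
  apply/seteqP; split => A; rewrite /within/=; last by apply: filterS.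
  by apply: filterS => h; exact.
have -> // : (fun h : R => h^-1 *: (L (q + h *: dir i) - L q)) =
    (fun h => h^-1 *: ((L \o shift q) (h *: dir i) - L q)).
by apply/funext => h /=; rewrite (addrC q).
Qed.

Lemma C1_on_derivable (L : Larg -> R) i q : C1_on Ldom L -> Ldom q ->
  derivable L q (dir i).
Proof.
by move=> [_ /(_ (dir i))[dL _]] Lq; apply: (derivable_on_Ldom L i Lq).1; exact: dL.
Qed.

Lemma C1_on_continuous (L : Larg -> R) i : C1_on Ldom L ->
  {within Ldom, continuous (fun q => 'D_(dir i) L q)}.
Proof.
move=> [_ /(_ (dir i))[_ ]]; apply: subspace_eq_continuous => q.
by rewrite inE => Lq; exact: (derivable_on_Ldom L i Lq).2.
Qed.

Definition dirs : seq (option ('I_n.+1 * 'I_m)) :=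
  None :: [seq Some jk | jk <- index_enum ('I_n.+1 * 'I_m)%type].

Lemma sum_dirs (V : zmodType) (F : option ('I_n.+1 * 'I_m) -> V) :
  \sum_(i <- dirs) F i = F None + \sum_j \sum_k F (Some (j, k)).
Proof.
by rewrite /dirs big_cons big_map pair_bigA; congr (_ + _); apply: eq_bigr => -[].
Qed.

Lemma shift_dirs t (X Y : 'M[R]_(n.+1, m)) (u w : R) :
  ((t, X + Y, u + w) : Larg) = (t, X, u) +
    \sum_(i <- dirs) (if i is Some jk then Y jk.1 jk.2 else w) *: dir i.
Proof.
pose ins (Z : 'M[R]_(n.+1, m)) : Larg := (0, Z, 0).
have insD : {morph ins : Y Z / Y + Z} by move=> Z Z'; congr (_, _, _); rewrite addr0.
have insZ k Z : ins (k *: Z) = k *: ins Z by congr (_, _, _); rewrite scaler0.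
have E : \sum_j \sum_k Y j k *: dir (Some (j, k)) = ins Y.
  rewrite {2}[Y]matrix_sum_delta (big_morph ins insD (erefl _)).
  apply: eq_bigr => j _; rewrite (big_morph ins insD (erefl _)).
  by apply: eq_bigr => k _; rewrite insZ.
rewrite sum_dirs E /ins /=; congr (_, _, _); rewrite /= ?scaler0 ?add0r ?addr0//.
by rewrite /GRing.scale/= mulr1.
Qed.

End Directions.

(** * The first variation *)

Section FirstVariation.
Context {R : realType} {n m : nat}.
Variables (a b : R) (L : @Larg R n m -> R).
Hypothesis ab : a < b.
Hypothesis C1L : C1_on (Ldom a b) L.
Notation I := (option ('I_n.+1 * 'I_m))%type.

Lemma mx_entry_norm p q (M : 'M[R]_(p, q)) i j : `|M i j| <= `|M|.
Proof.
rewrite [leRHS]/Num.norm/= mx_normrE.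
exact: (le_bigmax _ (fun ij => `|M ij.1 ij.2|) (i, j)).
Qed.

(** All the partial derivatives are packed into one vector, so that a single use of [PC_tube] or
    [PC_bounded] yields a radius or a bound common to all directions. *)
Definition gradL (q : @Larg R n m) : 'rV[R]_#|{: I}| :=
  \row_k 'D_(dir (enum_val k)) L q.

Lemma gradLE q i : 'D_(dir i) L q = gradL q 0 (enum_rank i).
Proof. by rewrite mxE enum_rankK. Qed.

Lemma gradL_continuous : {within Ldom a b, continuous gradL}.
Proof.
apply/subspace_continuousP => q Lq; apply: cvg_mx_entries => i j.
rewrite mxE; under eq_fun do rewrite mxE.
by have /subspace_continuousP := C1_on_continuous (i := enum_val j) C1L; exact.
Qed.

Definition norm1 (Y : 'M[R]_(n.+1, m)) : R := \sum_j \sum_k `|Y j k|.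

Lemma norm1Z (s : R) Y : norm1 (s *: Y) = `|s| * norm1 Y.
Proof.
rewrite /norm1 mulr_sumr; apply: eq_bigr => j _; rewrite mulr_sumr.
by apply: eq_bigr => k _; rewrite mxE normrM.
Qed.

Lemma norm1_ge0 Y : 0 <= norm1 Y.
Proof. by apply: sumr_ge0 => j _; apply: sumr_ge0. Qed.

Lemma PC_norm1 Y : PC a b Y -> PC a b (fun t => norm1 (Y t)).
Proof.
move=> pY; apply: PC_sum => // j; apply: PC_sum => // k.
apply: (PC_compT (f := fun r : R => `|r|)); first exact: norm_continuous.
exact: PC_entry.
Qed.

Lemma sum_norm_dirs (Y : 'M[R]_(n.+1, m)) (w : R) :
  \sum_(i <- dirs) `|if i is Some jk then Y jk.1 jk.2 else w| = `|w| + norm1 Y.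
Proof. by rewrite sum_dirs. Qed.

Lemma shift_norm t (X Y : 'M[R]_(n.+1, m)) (u w : R) :
  `|((t, X + Y, u + w) : @Larg R n m) - (t, X, u)| <= `|w| + norm1 Y.
Proof.
rewrite shift_dirs addrC addKr -sum_norm_dirs.
apply: le_trans (ler_norm_sum _ _ _) _; apply: ler_sum => i _.
by rewrite normrZ ler_piMr// dir_norm.
Qed.

Definition clamp (r w : R) : R := Num.max (- r) (Num.min w r).

Lemma clamp_id r w : `|w| <= r -> clamp r w = w.
Proof.
rewrite ler_norml => /andP[h1 h2]; rewrite /clamp.
by rewrite (min_idPl h2) (max_idPr h1).
Qed.

Lemma clamp_norm r w : 0 <= r -> `|clamp r w| <= r.
Proof.
move=> r0; rewrite ler_norml /clamp le_max lexx/= ge_max ge_min lexx orbT andbT.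
by rewrite ge0_cp.
Qed.

Lemma clamp_lipschitz r w w' : 0 <= r -> `|clamp r w - clamp r w'| <= `|w - w'|.
Proof.
move=> r0; rewrite /clamp.
wlog ww' : w w' / w <= w'.
  move=> h; have [|/ltW w'w] := leP w w'; first exact: h.
  by rewrite distrC [leRHS]distrC; exact: h.
rewrite [leRHS]distrC [leRHS]ger0_norm ?subr_ge0// ler_norml.
have h1 : Num.min w r <= Num.min w' r.
  by rewrite le_min !ge_min ww' lexx orbT.
have h2 : Num.min w' r <= Num.min w r + (w' - w).
  by rewrite -lerBlDr le_min lerBlDr addrC; case: (leP w' r) => ?; lra.
by case: (leP (- r) (Num.min w r)); case: (leP (- r) (Num.min w' r)) => *;
  apply/andP; split; lra.
Qed.

Lemma clamp_continuous r : 0 <= r -> continuous (clamp r).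
Proof.
move=> r0 w; apply/cvgrPdist_le => e e0; near=> w'.
apply: (le_trans (clamp_lipschitz _ _ r0)); near: w'.
by have /cvgrPdist_le := @cvg_id _ (nbhs w); exact.
Unshelve. all: by end_near. Qed.

(** The numbers [l i] are free: [l = 0] gives Lipschitz estimates, while the partial derivatives at
    the base point give the expansion to first order. *)
Lemma taylor t (X Y : 'M[R]_(n.+1, m)) (u w : R) (l : I -> R) (e : R) :
  t \in `[a, b] ->
  (forall i q, Ldom a b q -> `|q - (t, X, u)| <= `|w| + norm1 Y ->
    `|'D_(dir i) L q - l i| <= e) ->
  `|L (t, X + Y, u + w) - L (t, X, u) -
     (w * l None + \sum_j \sum_k Y j k * l (Some (j, k)))| <= e * (`|w| + norm1 Y).
Proof.
move=> tab He; have := @sum_increment R (@Larg R n m) (Ldom a b) L _ dirs dir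
  (fun i => if i is Some jk then Y jk.1 jk.2 else w) l (t, X, u) e.
rewrite -shift_dirs sum_norm_dirs sum_dirs; apply => //.
- by move=> i q k; exact: Ldom_dir.
- by move=> i q; exact: C1_on_derivable.
- exact: dir_norm.
- by move=> i q _; exact: He.
Qed.

Variables (X Y : R -> 'M[R]_(n.+1, m)) (u psi Q : R -> R).
Hypothesis (pX : PC a b X) (pY : PC a b Y) (pu : PC a b u).

Let J t : @Larg R n m := (t, X t, u t).

Hypothesis apsi : antiderivative a b psi (fun t => - (psi t * 'D_(dir None) L (J t))).
Hypothesis psib : psi b = 1.
Hypothesis aQ : antiderivative a b Q (fun t =>
  psi t * \sum_j \sum_k Y t j k * 'D_(dir (Some (j, k))) L (J t)).
Hypothesis Qa : Q a = 0.

Lemma PC_point (X' : R -> 'M[R]_(n.+1, m)) (u' : R -> R) :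
  PC a b X' -> PC a b u' -> PC a b (fun t => (t, X' t, u' t) : @Larg R n m).
Proof.
move=> pX' pu'; apply: (PC_pair _ pu'); apply: (PC_pair _ pX').
by apply: (PC_within ab); apply: continuous_subspaceT => t; exact: cvg_id.
Qed.

Lemma PC_L (X' : R -> 'M[R]_(n.+1, m)) (u' : R -> R) :
  PC a b X' -> PC a b u' -> PC a b (fun t => L (t, X' t, u' t)).
Proof.
move=> pX' pu'; have [cL _] := C1L.
have := @PC_comp R a b _ _ (Ldom a b) L (fun t => (t, X' t, u' t)).
move=> h; apply: h; [exact: Ldom_closed|exact: cL|by []|exact: PC_point].
Qed.

Let tube e : 0 < e -> exists2 r, 0 < r & forall t, t \in `[a, b] ->
  forall i q, Ldom a b q -> `|q - J t| <= r ->
  `|'D_(dir i) L q - 'D_(dir i) L (J t)| <= e.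
Proof.
move=> e0; have [//|r r0 Hr] := PC_tube (@Ldom_closed R n m a b)
  gradL_continuous _ (PC_point pX pu) e0.
exists r => // t tab i q Lq qJ; rewrite !gradLE.
have -> : gradL q 0 (enum_rank i) - gradL (J t) 0 (enum_rank i) =
    (gradL q - gradL (J t)) 0 (enum_rank i) by rewrite !mxE.
exact: le_trans (mx_entry_norm _ _ _) (Hr t tab q Lq qJ).
Qed.

Let gradL_bounded : exists2 B, 0 < B & forall t, t \in `[a, b] -> forall i,
  `|'D_(dir i) L (J t)| <= B.
Proof.
have := PC_comp (@Ldom_closed R n m a b) gradL_continuous _ (PC_point pX pu).
move=> /(_ (fun t tab => tab))/PC_bounded[B B0 HB]; exists B => // t tab i.
by rewrite gradLE (le_trans (mx_entry_norm _ _ _))// HB.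
Qed.

(** [W s] and the range [s0] are fixed once and for all; only [s1] depends on [e]. The bound
    [C * |s|] controls the nearness of the perturbed trajectory, and it also makes the Taylor error
    small compared with [|s|]. *)
Lemma first_variation : exists (W : R -> R -> R) (s0 C : R), [/\ 0 < s0, 0 < C,
  (forall s, `|s| <= s0 -> [/\
     antiderivative a b (W s)
       (fun t => L (t, X t + s *: Y t, u t + W s t) - L (J t)),
     W s a = 0 & forall t, t \in `[a, b] -> `|W s t| <= C * `|s|]) &
  forall e, 0 < e -> exists2 s1, 0 < s1 & forall s, `|s| <= s0 -> `|s| <= s1 ->
    `|W s b - s * Q b| <= e * `|s|].
Proof.
have [B B0 HB] := gradL_bounded.
have [r1 r10 Hr1] := tube (ltr01 : 0 < 1 :> R).
(* Along the reference jet the partial derivatives are at most [B], and they vary by at most 1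
   within the radius [r1]. *)
pose K := B + 1; have K0 : 0 < K by rewrite addr_gt0.
have HK t : t \in `[a, b] -> forall i q, Ldom a b q -> `|q - J t| <= r1 ->
    `|'D_(dir i) L q - 0| <= K.
  move=> tab i q Lq qJ; rewrite subr0 -(subrK ('D_(dir i) L (J t)) ('D_(dir i) L q)).
  rewrite (le_trans (ler_normD _ _))// addrC lerD ?HB//; exact: Hr1.
have [CY CY0 HCY] : exists2 CY, 0 < CY & forall t, t \in `[a, b] -> norm1 (Y t) <= CY.
  have [CY CY0 H] := PC_bounded (PC_norm1 pY); exists CY => // t /H.
  by rewrite ger0_norm ?norm1_ge0.
(* The Lipschitz estimate uses up [r1] in four parts: [r] for [s *: Y t], [r] for the clamped base
   value, and [2 * r] for the difference of two clamped values. *)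
pose r := r1 / 4; have r0 : 0 < r by rewrite divr_gt0.
pose E := expR (2 * K * (b - a)); have E0 : 0 < E by exact: expR_gt0.
have S0 (Z : 'M[R]_(n.+1, m)) : \sum_j \sum_k Z j k * (0 : R) = 0.
  by rewrite big1// => j _; rewrite big1// => k _; rewrite mulr0.
(* The bound given by [picard] for a Lipschitz constant [K] and a right-hand side of size
   [K * (CY * |s|)] at 0. *)
pose C := CY * E; have C0 : 0 < C by rewrite mulr_gt0.
have YC (s : R) t : t \in `[a, b] -> norm1 (s *: Y t) <= `|s| * CY.
  by move=> tab; rewrite norm1Z ler_wpM2l// HCY.
(* The first entry keeps [s *: Y t] within [r]; the second keeps the solution within [r], where the
   clamp does nothing. *)
pose s0 := Num.min (r / CY) (r / C).
have s00 : 0 < s0 by rewrite lt_min !divr_gt0.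
have sCY (s : R) : `|s| <= s0 -> `|s| * CY <= r.
  by rewrite le_min ler_pdivlMr// => /andP[].
have sC (s : R) : `|s| <= s0 -> C * `|s| <= r.
  by rewrite le_min => /andP[_]; rewrite ler_pdivlMr// mulrC.
have : forall s : R, exists w, `|s| <= s0 -> [/\
    antiderivative a b w (fun t => L (t, X t + s *: Y t, u t + w t) - L (J t)),
    w a = 0 & forall t, t \in `[a, b] -> `|w t| <= C * `|s|].
  move=> s; have [ss0|//] := leP `|s| s0; last by exists (fun=> 0).
  (* The clamp makes f globally Lipschitz; the solution stays in the range
     where the clamp is the identity. *)
  pose f t w := L (t, X t + s *: Y t, u t + clamp r w) - L (J t).
  have [||t v v' tab|t tab|w [aw wa wC]] := @picard R a b f K (K * (CY * `|s|)) ab K0.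
  - by rewrite !mulr_ge0// ltW.
  - move=> w cw; apply: PC_add; last exact: (PC_opp (PC_L pX pu)).
    apply: PC_L; apply: PC_add; [exact: pX| |exact: pu|].
      by apply: PC_scale; [exact: PC_cst|exact: pY].
    apply: (PC_compT (f := clamp r)); last exact: (PC_within ab cw).
    exact/clamp_continuous/ltW.
  - have := @taylor t (X t + s *: Y t) 0 (u t + clamp r v')
      (clamp r v - clamp r v') (fun=> 0) K tab _.
    rewrite addr0 (_ : u t + clamp r v' + (clamp r v - clamp r v') =
      u t + clamp r v); last by ring.
    rewrite /= mulr0 add0r.
    rewrite S0 subr0.
    have n0 : norm1 0 = 0 by rewrite -(scale0r 0) norm1Z normr0 mul0r.
    rewrite n0 addr0 => h; apply: (le_trans (_ : _ <= K * `|clamp r v - clamp r v'|)).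
      rewrite /f (_ : _ - _ - _ = L (t, X t + s *: Y t, u t + clamp r v) -
        L (t, X t + s *: Y t, u t + clamp r v')); last by ring.
      apply: h => i q Lq qp; apply: (HK t tab) => //.
      apply: le_trans (ler_distD (t, X t + s *: Y t, u t + clamp r v') _ _) _.
      apply: le_trans (lerD qp (shift_norm _ _ _ _ _)) _.
      have := YC s t tab; have := sCY s ss0; have := clamp_norm v' (ltW r0).
      have := clamp_norm v (ltW r0); have := ler_normB (clamp r v) (clamp r v').
      rewrite /r; lra.
    by apply: ler_wpM2l; [exact: ltW|apply: clamp_lipschitz; exact: ltW].
  - have := @taylor t (X t) (s *: Y t) (u t) 0 (fun=> 0) K tab _.
    have c0 : clamp r 0 = 0 by apply: clamp_id; rewrite normr0; exact: ltW.
    rewrite /= normr0 mul0r !add0r addr0 S0 subr0 /f c0 addr0 => h.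
    apply: (le_trans (h _)).
      move=> i q Lq qp; apply: (HK t tab) => //; apply: (le_trans qp).
      by apply: le_trans (YC s t tab) _; apply: le_trans (sCY _ ss0) _; rewrite /r; lra.
    apply: ler_wpM2l; first exact: ltW.
    by rewrite [leRHS]mulrC; exact: YC.
  - exists w => _.
    have wC' t : t \in `[a, b] -> `|w t| <= C * `|s|.
      move=> /wC; rewrite -/E [leRHS](_ : _ = C * `|s|)//.
      by rewrite /C; field; rewrite gt_eqF.
    split => //; apply: antiderivative_eq aw; apply: but_finitelyT => t /oo_cc tab.
    by rewrite /f clamp_id// (le_trans (wC' _ tab))// sC.
move=> /choice[W HW]; exists W, s0, C; split => // e e0.
have [P P0 HP] : exists2 P, 0 < P & forall t, t \in `[a, b] -> `|psi t| <= P.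
  by have [c _] := apsi; exact: (PC_bounded (PC_within ab c)).
(* A Taylor error of relative size [e / M], on an increment of size at most [(CY + C) * |s|],
   multiplied by [psi] and integrated over [[a, b]], adds up to at most [e * |s|]. *)
pose M := P * (CY + C) * (b - a).
have M0 : 0 < M.
  apply: mulr_gt0; last by rewrite subr_gt0.
  by apply: mulr_gt0 => //; exact: addr_gt0.
have [r2 r20 Hr2] := tube (divr_gt0 e0 M0).
exists (r2 / (CY + C)); first by rewrite divr_gt0 ?addr_gt0.
move=> s ss0; rewrite ler_pdivlMr ?addr_gt0// => ss1.
have [aW Wa WC] := HW _ ss0.
pose D := e / M * P * (CY + C) * `|s|.
have aG : antiderivative a b (fun t => D * (t - a)) (fun=> D).
  have := antiderivativeZ D (antiderivativeB (antiderivative_id a b)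
    (antiderivative_cst a b a)).
  by apply: antiderivative_eq; apply: but_finitelyT => t _; rewrite subr0 mulr1.
(* Since psi' = - psi dL/dz, the terms of first order in W cancel in (psi W)'. *)
have aF := antiderivativeB (antiderivativeM apsi aW) (antiderivativeZ s aQ).
have bab : b \in `[a, b] by rewrite in_itv/= lexx (ltW ab).
have := antiderivative_le aF aG _ _ bab.
rewrite psib mul1r Wa Qa !mulr0 !subrr normr0 mulr0 lexx => h.
apply: le_trans (h _ isT) _; last first.
  rewrite (_ : D * (b - a) = e / M * (P * (CY + C) * (b - a)) * `|s|).
    by rewrite -/M divfK ?gt_eqF.
  by rewrite /D; ring.
apply: but_finitelyT => t /oo_cc tab.
have := @taylor t (X t) (s *: Y t) (u t) (W s t)
  (fun i => 'D_(dir i) L (J t)) (e / M) tab _.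
have wY : `|W s t| + norm1 (s *: Y t) <= (CY + C) * `|s|.
  by have := YC s t tab; have := WC t tab; lra.
move=> h2; have {}h2 := h2 _.
rewrite -[in X in _ - X](_ : s * (\sum_j \sum_k Y t j k * 'D_(dir (Some (j, k))) L (J t)) =
  \sum_j \sum_k (s *: Y t) j k * 'D_(dir (Some (j, k))) L (J t)) in h2; last first.
  rewrite mulr_sumr; apply: eq_bigr => j _; rewrite mulr_sumr.
  by apply: eq_bigr => k _; rewrite mxE mulrA.
set T := \sum_j _ in h2 *.
set d := _ - _ - _ in h2.
rewrite (_ : _ - _ = psi t * d); last by rewrite /d; ring.
rewrite normrM; apply: (le_trans (ler_pM _ _ (HP t tab) (h2 _))) => //.
  move=> i q Lq qp; apply: Hr2 => //; apply: (le_trans qp); apply: (le_trans wY).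
  by rewrite mulrC.
apply: (le_trans (ler_wpM2l (ltW P0) (ler_wpM2l _ wY))).
  by rewrite divr_ge0 ?ltW.
by rewrite /D le_eqVlt; apply/orP; left; apply/eqP; ring.
Qed.

End FirstVariation.

(** * Perturbed jets and iterated primitives *)

Section Jets.
Context {R : realType}.
Variables a b : R.
Hypothesis ab : a < b.

Lemma antiderivative_eql (F G f : R -> R) :
  (forall t, t \in `[a, b] -> F t = G t) ->
  antiderivative a b F f -> antiderivative a b G f.
Proof.
move=> FG [cF dF]; split.
  by apply: subspace_eq_continuous cF => t; rewrite inE => /FG.
apply: but_finitely_imp dF => t tab /(has_D1_interior _ _ tab) dF.
by apply/(has_D1_interior _ _ tab); apply: has_D1_eq dF => //; exact: oo_cc.
Qed.

(** The tail integral is the total integral minus the primitive from [a], so the exponential solves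
    the adjoint equation [psi' = - psi f]. *)
Lemma antiderivative_expR_tail (f : R -> R) : PC a b f ->
  antiderivative a b (fun t => expR (\int[lebesgue_measure]_(s in `[t, b]) f s))
    (fun t => - (expR (\int[lebesgue_measure]_(s in `[t, b]) f s) * f t)).
Proof.
move=> pf; have intf := PC_integrable ab pf.
pose g t := primitive a f b - primitive a f t.
have gE t : t \in `[a, b] -> g t = \int[lebesgue_measure]_(s in `[t, b]) f s.
  rewrite in_itv/= => /andP[at_ tb]; rewrite /g /primitive Rintegral_itvB//.
  apply: Rintegral_itv_obnd_cbnd.
  apply: integrableS intf => //.
  by move=> s /=; rewrite !in_itv/= => /andP[ts ->]; rewrite (le_trans at_ (ltW ts)).
have ag : antiderivative a b g (fun t => - f t).
  have := antiderivativeB (antiderivative_cst a b (primitive a f b)) (primitiveP ab pf).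
  by apply: antiderivative_eq; apply: but_finitelyT => t _; rewrite sub0r.
have : antiderivative a b (expR \o g) (fun t => - (expR (g t) * f t)).
  have [cg dg] := ag; split.
    by move=> t; exact: (cvg_comp _ _ (cg t) (@continuous_expR R (g t))).
  apply: but_finitely_imp dg => t _ /(is_derive1_comp (is_derive_expR _)) h.
  by apply: (is_derive_eq h); rewrite mulrN.
move=> aE; apply: (antiderivative_eql (F := expR \o g)).
  by move=> t tab /=; rewrite gE.
by apply: antiderivative_eq aE; apply: but_finitelyT => t /oo_cc tab; rewrite gE.
Qed.

Lemma norm0_le (V : normedModType R) (f : R -> V) e :
  (forall t, t \in `[a, b] -> `|f t| <= e) -> norm0 a b f <= e.
Proof.
move=> fe; apply: ge_sup; last by move=> _ [t tab <-]; exact: fe.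
by exists `|f a|, a => //=; rewrite in_itv/= lexx ltW.
Qed.

Lemma PCn_PC (V : normedModType R) n (x : R -> V) j : (0 < n)%N -> PCn a b n x ->
  (j <= n)%N -> PC a b (Dn a b j x).
Proof.
case: n => [//|n] _ [[_ cx] [_ _ px]]; rewrite leq_eqVlt => /orP[/eqP->|jn].
  by rewrite /Dn iterS.
by apply: (PC_within ab); apply: cx.
Qed.

(** Up to order [n - 1] the derivatives are linear everywhere. At order [n] this holds only off a
    finite set, where [D1] is a genuine derivative. *)
Lemma PCn_comb (V : normedModType R) n (x h : R -> V) (c : R) : (0 < n)%N ->
  PCn a b n x -> PCn a b n h ->
  PCn a b n (fun t => x t + c *: h t) /\
  but_finitely a b (fun t => forall j, (j <= n)%N ->
    Dn a b j (fun t => x t + c *: h t) t = Dn a b j x t + c *: Dn a b j h t).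
Proof.
case: n => [//|n] _ [Cx Px] [Ch Ph].
have [Cxh Dxh] := Ck_comb ab c Cx Ch; have [Pxh DP] := PC1_comb ab c Px Ph.
have Dxh' s : s \in `[a, b] -> Dn a b n x s + c *: Dn a b n h s =
    Dn a b n (fun t => x t + c *: h t) s by move=> sab; rewrite Dxh.
split.
  by split; [exact: Cxh|exact: (PC1_eq ab Dxh' Pxh)].
apply: but_finitely_imp DP => t /oo_cc tab E j.
rewrite leq_eqVlt => /orP[/eqP->|jn]; last exact: Dxh.
by rewrite /Dn !iterS -E; symmetry; exact: (D1_eq Dxh' tab).
Qed.

Variables (m : nat) (d : R -> 'rV[R]_m).
Hypothesis pd : PC a b d.

Fixpoint iter_primitive k : R -> 'rV[R]_m :=
  if k is k'.+1 then
    fun t => \row_i primitive a (fun s => iter_primitive k' s 0 i) t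
  else d.

Lemma iter_primitive_spec k : [/\ PC a b (iter_primitive k),
  forall i j, antiderivative a b (fun t => iter_primitive k.+1 t i j)
                       (fun t => iter_primitive k t i j) &
  {within [set` `[a, b]], continuous (iter_primitive k.+1)}].
Proof.
elim: k => [|k [_ _ IHk]].
  have ad i j : antiderivative a b (fun t => iter_primitive 1 t i j)
                       (fun t => iter_primitive 0 t i j).
    apply: (antiderivative_eql (F := primitive a (fun s => d s 0 j))).
      by move=> t _; rewrite /= mxE.
    by rewrite (ord1 i); exact: (primitiveP ab (PC_entry 0 j pd)).
  by have [[c _ _] _] := PC1_antiderivatives ab ad pd.
have pk : PC a b (iter_primitive k.+1) by exact: (PC_within ab IHk).
have ad i j : antiderivative a b (fun t => iter_primitive k.+2 t i j)
                       (fun t => iter_primitive k.+1 t i j).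
  apply: (antiderivative_eql (F := primitive a (fun s => iter_primitive k.+1 s 0 j))).
    by move=> t _; rewrite /= mxE.
  by rewrite (ord1 i); exact: (primitiveP ab (PC_entry 0 j pk)).
by have [[c _ _] _] := PC1_antiderivatives ab ad pk.
Qed.

Lemma iter_primitive0 k : iter_primitive k.+1 a = 0.
Proof. by apply/rowP => i; rewrite !mxE primitive0. Qed.

Lemma iter_primitive_D1 k t : t \in `[a, b] ->
  has_D1 a b (iter_primitive k.+2) t (iter_primitive k.+1 t).
Proof.
move=> tab; apply: has_D1_mx => i j.
have [_ ad _] := iter_primitive_spec k.+1; have [_ _ ck] := iter_primitive_spec k.
apply: (has_D1_antiderivative (f := fun t => iter_primitive k.+1 t i j)
  (ad i j) tab).
move/subspace_continuousP : ck => /(_ t tab) ckt.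
exact: (cvg_comp _ _ ckt (@coord_continuous R 1 m i j _)).
Qed.

(** The index [k.+1] keeps one primitive in hand: the last differentiation, which returns [d], is
    valid only off a finite set and is treated in [PCn_iter_primitive]. *)
Lemma Dn_iter_primitive j k t : t \in `[a, b] ->
  Dn a b j (iter_primitive (j + k.+1)) t = iter_primitive k.+1 t.
Proof.
elim: j k t => [//|j IHj] k t tab; rewrite /Dn iterS.
rewrite (D1_eq (g := iter_primitive k.+2)) => [|s sab|//]; last first.
  by rewrite addSnnS; exact: IHj.
exact: (has_D1P ab tab (iter_primitive_D1 tab)).2.
Qed.

Lemma PCn_iter_primitive n : (0 < n)%N -> PCn a b n (iter_primitive n) /\
  but_finitely a b (fun t => forall j, (j <= n)%N ->
    Dn a b j (iter_primitive n) t = iter_primitive (n - j) t).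
Proof.
case: n => [//|n] _.
have D j t : (j <= n)%N -> t \in `[a, b] ->
    Dn a b j (iter_primitive n.+1) t = iter_primitive (n - j).+1 t.
  by move=> jn tab; rewrite -(Dn_iter_primitive j (n - j) tab) addnS subnKC.
have Dn' t : t \in `[a, b] -> iter_primitive 1 t = Dn a b n (iter_primitive n.+1) t.
  by move=> tab; rewrite D// subnn.
have [_ ad _] := iter_primitive_spec 0.
have [p1 d1] := PC1_antiderivatives ab ad pd.
split.
  split; last exact: (PC1_eq ab Dn' p1).
  split.
    move=> j t jn tab; apply: (derivable_on_eq ab (f := iter_primitive (n - j).+1)) => //.
      by move=> s sab; rewrite D// ltnW.
    have := iter_primitive_D1 (k := (n - j.+1)%N) tab; rewrite subnSK//.
    by move=> /(has_D1P ab tab)[].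
  move=> j jn; have [_ _ c] := iter_primitive_spec (n - j).
  by apply: subspace_eq_continuous c => t; rewrite inE => tab; symmetry; exact: D.
apply: but_finitely_imp d1 => t /oo_cc tab E j.
rewrite leq_eqVlt => /orP[/eqP->|jn]; last by rewrite D// subSn.
by rewrite subnn -E /Dn iterS; apply: D1_eq => // s sab; symmetry; exact: Dn'.
Qed.

End Jets.

(** * Costates *)

Section Costates.
Context {R : realType} {m : nat}.
Implicit Types (a b c d t : R).

(** The point [t] is approached from a side that lies in [[c, d]], along points where [f = g];
    limits are unique. *)
Lemma eq_but_finitely (V : normedModType R) c d (f g : R -> V) t : c < d ->
  {within [set` `[c, d]], continuous f} -> {within [set` `[c, d]], continuous g} ->
  but_finitely c d (fun t => f t = g t) -> t \in `[c, d] -> f t = g t.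
Proof.
move=> cd cf cg fg tcd.
have key (F : set_system R) : ProperFilter F -> F --> nbhs t ->
    (\forall s \near F, s \in `]c, d[) -> (\forall s \near F, s \in `[c, d] -> f s = g s) ->
    f t = g t.
  move=> PF Ft Fcd Ffg.
  have Fcd' : \forall s \near F, [set` `[c, d]] s by apply: filterS Fcd => s; exact: oo_cc.
  have ft := @cvg_within_comp R V R F _ f id t _ cf tcd Fcd' Ft.
  have gt := @cvg_within_comp R V R F _ g id t _ cg tcd Fcd' Ft.
  have E : {near F, g =1 f}.
    near=> s; symmetry; have /= := near Ffg s; apply => //.
    by apply: oo_cc; near: s.
  have gt' : f s @[s --> F] --> g t 
    by move=> A /gt hA; apply: filterS2 E hA => s /= ->.
  have ft' : f s @[s --> F] --> f t by exact: ft.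
  by have := @cvg_unique _ (@norm_hausdorff R V) (f s @[s --> F]) _; apply.
have [td|dt] := ltP t d.
  have tcd' : t \in `[c, d[ by move: tcd; rewrite !in_itv/= td => /andP[->].
  apply: (key (t^'+)).
  - exact: cvg_within.
  - exact: at_right_itv.
  - exact: at_right_dnbhs (but_finitely_near t fg).
have tcd' : t \in `]c, d].
  by move: tcd; rewrite !in_itv/= => /andP[_ ->]; rewrite (lt_le_trans cd dt).
apply: (key (t^'-)).
- exact: cvg_within.
- exact: at_left_itv.
- exact: at_left_dnbhs (but_finitely_near t fg).
Unshelve. all: by end_near. Qed.

Lemma has_D1_sum (V : normedModType R) a b k (c : nat -> R) (f : nat -> R -> V)
    (l : nat -> V) t :
  (forall i, (i < k)%N -> has_D1 a b (f i) t (l i)) ->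
  has_D1 a b (fun t => \sum_(i < k) c i *: f i t) t (\sum_(i < k) c i *: l i).
Proof.
elim: k => [_|k IHk fl].
  rewrite big_ord0 /has_D1.
  under eq_fun do rewrite !big_ord0 subrr scaler0.
  exact: cvg_cst.
rewrite big_ord_recr; under eq_fun do rewrite big_ord_recr.
apply: (has_D1_comb (f := fun t => \sum_(i < k) c i *: f i t) (g := f k));
  last exact: fl.
by apply: IHk => i ik; apply: fl; rewrite ltnS ltnW.
Qed.

Lemma within_continuous_sum (V : normedModType R) (S : set R) k (c : nat -> R)
    (f : nat -> R -> V) :
  (forall i, (i < k)%N -> {within S, continuous (f i)}) ->
  {within S, continuous (fun t => \sum_(i < k) c i *: f i t)}.
Proof.
elim: k => [_|k IHk cf].
  by under eq_fun do rewrite big_ord0; move=> t; exact: cvg_cst.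
under eq_fun do rewrite big_ord_recr; move=> t; apply: cvgD.
  by apply: IHk => i ik; apply: cf; rewrite ltnS ltnW.
by apply: cvgZr; exact: cf.
Qed.

(* The function [H j] of the header. *)
Fixpoint costate a b (G : nat -> R -> 'rV[R]_m) k : R -> 'rV[R]_m :=
  if k is k'.+1 then
    fun t => \row_i (primitive a (fun s => (G k' s - costate a b G k' s) 0 i) t -
                     primitive a (fun s => (G k' s - costate a b G k' s) 0 i) b)
  else fun=> 0.

Variables (a b : R) (G : nat -> R -> 'rV[R]_m).
Hypothesis ab : a < b.
Hypothesis pG : forall j, PC a b (G j).

Lemma costate_end j : costate a b G j b = 0.
Proof. by case: j => [//|j]; apply/rowP => i; rewrite !mxE subrr. Qed.

Lemma costate_step j : PC a b (costate a b G j) -> forall i k,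
  antiderivative a b (fun t => costate a b G j.+1 t i k)
    (fun t => (G j t - costate a b G j t) i k).
Proof.
move=> pj i k; set f := fun t => (G j t - costate a b G j t) i k.
have pf : PC a b f.
  apply: (PC_entry (M := fun t => G j t - costate a b G j t)).
  exact: (PC_add (pG j) (PC_opp pj)).
apply: (antiderivative_eql (F := fun t => primitive a f t - primitive a f b)).
  by move=> t _; rewrite [in RHS]/= mxE /f (ord1 i).
have := antiderivativeB (primitiveP ab pf) (antiderivative_cst a b (primitive a f b)).
by apply: antiderivative_eq; apply: but_finitelyT => t _; rewrite subr0.
Qed.

Lemma costate_PC j : PC a b (costate a b G j).
Proof.
elim: j => [|j IHj]; first exact: (PC_cst ab).
have [[c _ _] _] := PC1_antiderivatives ab (costate_step IHj) (PC_add (pG j) (PC_opp IHj)).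
exact: (PC_within ab c).
Qed.

Lemma costate_PC1 j : PC1 a b (costate a b G j.+1) /\
  but_finitely a b (fun t => D1 a b (costate a b G j.+1) t = G j t - costate a b G j t).
Proof.
exact: (PC1_antiderivatives ab (costate_step (costate_PC j))
  (PC_add (pG j) (PC_opp (costate_PC j)))).
Qed.

Lemma costate_continuous j : {within [set` `[a, b]], continuous (costate a b G j)}.
Proof.
case: j => [|j]; first by move=> t; exact: cvg_cst.
by have [[]] := costate_PC1 j.
Qed.

Variable n : nat.
Hypothesis costate_n : but_finitely a b (fun t => G n t = costate a b G n t).

(** The nested reading of the sum is the recursion [H j = G j - (H (j+1))']: the witness at each
    level is the next costate, and [costate_n] closes the innermost one. *)
Lemma alt_dsum_costate k j : (k + j = n)%N ->
  alt_dsum a b k (fun i => G (i + j)%N) (costate a b G j).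
Proof.
elim: k j => [|k IHk] j kj.
  rewrite /= add0n in kj *; subst j.
  by apply: but_finitely_imp costate_n => t _ ->.
exists (costate a b G j.+1); have [p1 d1] := costate_PC1 j; split; first exact: p1.
  have := IHk j.+1; rewrite addnS => /(_ kj).
  by rewrite (_ : (fun i => G (i + j.+1)%N) = (fun i => G (i.+1 + j)%N))//;
    apply/funext => i; rewrite addSnnS.
by apply: but_finitely_imp d1 => t _ ->; rewrite opprB addrC subrK.
Qed.

Variables c d : R.
Hypotheses (ac : a <= c) (cd : c < d) (db : d <= b).
Hypothesis CG : forall j, (j <= n)%N -> Ck c d j (G j).

Let sub_cd t : t \in `[c, d] -> t \in `[a, b].
Proof.
by rewrite !in_itv/= => /andP[ct td]; rewrite (le_trans ac ct) (le_trans td db).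
Qed.

(** Induction downwards from [j = n]. Differentiating the formula for [H (j+1)] term by term gives
    the one for [H j] off a finite set, and continuity of both sides on [[c, d]] extends it to every
    point. *)
Lemma costate_sum k j t : (k + j = n)%N -> t \in `[c, d] ->
  costate a b G j t = \sum_(i < k.+1) (-1) ^+ i *: Dn c d i (G (i + j)%N) t.
Proof.
have ccost j' : {within [set` `[c, d]], continuous (costate a b G j')}.
  by apply: continuous_subspaceW (@costate_continuous j') => s; exact: sub_cd.
have cS k' j' : (k' + j' <= n)%N -> {within [set` `[c, d]], continuous
    (fun t => \sum_(i < k'.+1) (-1) ^+ i *: Dn c d i (G (i + j')%N) t)}.
  move=> kj; apply: (within_continuous_sum (c := fun i => (-1) ^+ i)
    (f := fun i => Dn c d i (G (i + j')%N))) => i ik.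
  have [_ cG] := CG (leq_trans (leq_add (ik : (i <= k')%N) (leqnn j')) kj).
  by apply: cG; exact: leq_addr.
elim: k j t => [|k IHk] j t kj tcd.
  rewrite add0n in kj; subst j.
  apply: (eq_but_finitely cd (ccost n) (cS 0%N n _)) => //.
  apply: but_finitelyW ac db _; apply: but_finitely_imp costate_n => s _ <-.
  by rewrite big_ord1 expr0 scale1r.
apply: (eq_but_finitely cd (ccost j) (cS k.+1 j _)) => //; first by rewrite kj.
have [[_ dj _] Dj] := costate_PC1 j.
pose l s := \sum_(i < k.+1) (-1) ^+ i *: Dn c d i.+1 (G (i + j.+1)%N) s.
have dS s : s \in `[c, d] -> has_D1 c d (costate a b G j.+1) s (l s).
  move=> scd.
  have : has_D1 c d (fun t => \sum_(i < k.+1) (-1) ^+ i *: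
      Dn c d i (G (i + j.+1)%N) t) s (l s).
    apply: (has_D1_sum (c := fun i => (-1) ^+ i)
      (f := fun i => Dn c d i (G (i + j.+1)%N))
      (l := fun i => Dn c d i.+1 (G (i + j.+1)%N) s)) => i ik.
    have [dG _] : Ck c d (i + j.+1) (G (i + j.+1)%N).
      by apply: CG; rewrite -kj addSnnS leq_add2r.
    by rewrite /Dn iterS; apply: derivable_on_has_D1; apply: dG; rewrite // addnS ltnS leq_addr.
  apply: has_D1_eq => // r rcd; symmetry; apply: IHk => //.
  by rewrite addnS.
have : but_finitely c d (fun s => derivable_on [set` `[a, b]] (costate a b G j.+1) s 1 /\
    D1 a b (costate a b G j.+1) s = G j s - costate a b G j s).
  exact: but_finitelyW ac db (but_finitely_and dj Dj).
apply: but_finitely_imp => s scd [/derivable_on_has_D1 + E]; rewrite E.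
have sab : s \in `]a, b[.
  move: scd; rewrite !in_itv/= => /andP[cs sd].
  by rewrite (le_lt_trans ac cs) (lt_le_trans sd db).
(* At interior points of [[c, d]] the derivatives relative to [[a, b]] and to [[c, d]] are both the
   two-sided one. *)
move=> /(has_D1_interior _ _ sab)/(has_D1_interior _ _ scd).
move=> /(has_D1P cd (oo_cc scd))[_ D1s].
have [_] := has_D1P cd (oo_cc scd) (dS _ (oo_cc scd)); rewrite D1s => ls.
rewrite (_ : costate a b G j s = G j s - l s); last by rewrite -ls opprB addrC subrK.
rewrite big_ord_recl expr0 scale1r add0n; congr (_ + _).
rewrite /l -sumrN; apply: eq_bigr => i _; by rewrite lift0 exprS mulN1r scaleNr addSnnS.
Qed.

End Costates.

Lemma antiderivative_PC1 {R : realType} (a b : R) (F f : R -> R) : a < b ->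
  antiderivative a b F f -> PC a b f -> PC1 a b F.
Proof.
move=> ab aF pf; have dF := antiderivative_D1 ab aF; have [cF _] := aF; split.
- exact: cF.
- by apply: but_finitely_imp dF => t _ [].
- by apply: PC_eq pf; apply: but_finitely_imp dF => t _ [_ ->].
Qed.

(** If [q] were nonzero, the error [|q| / 2 * |s|] would be too small to undo the sign of [s * q],
    and [w s] and [w (- s)] would have strictly opposite signs. *)
Lemma linear_part_eq0 {R : realType} (w : R -> R) (q r : R) : 0 < r ->
  (forall e, 0 < e -> exists2 r', 0 < r' & forall s, `|s| <= r -> `|s| <= r' ->
    `|w s - s * q| <= e * `|s|) ->
  (forall s, `|s| <= r -> 0 <= w s) \/ (forall s, `|s| <= r -> w s <= 0) ->
  q = 0.
Proof.
move=> r0 wq sgn; apply/eqP; apply: contraT => q0.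
have e0 : 0 < `|q| / 2 by rewrite divr_gt0 ?normr_gt0.
have [r' r'0 Hr'] := wq _ e0.
pose s := Num.min r r'; have s0 : 0 < s by rewrite lt_min r0.
have ns : `|s| = s by rewrite gtr0_norm.
have sr : s <= r by rewrite ge_min lexx.
have sr' : s <= r' by rewrite ge_min lexx orbT.
have := Hr' s; have := Hr' (- s); rewrite normrN ns => /(_ sr sr') + /(_ sr sr').
rewrite !ler_norml => /andP[h1 h2] /andP[h3 h4].
have sq : 0 < `|q| / 2 * s by rewrite mulr_gt0.
have wp : (0 <= w s /\ 0 <= w (- s)) \/ (w s <= 0 /\ w (- s) <= 0).
  by case: sgn => sgn; [left|right]; split; apply: sgn; rewrite ?normrN ns.
have qs : `|q| = q \/ `|q| = - q.
  by have [q1|q1] := leP 0 q; [left; rewrite ger0_norm|right; rewrite ltr0_norm].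
have E : `|q| / 2 * s = (`|q| * s) / 2 by field.
have E' : - s * q = - (s * q) by ring.
rewrite E in h1 h2 h3 h4 sq; rewrite E' in h1 h2.
case: qs => qs; rewrite qs ?mulNr (mulrC q) in h1 h2 h3 h4 sq; lra.
Qed.

(** * The Euler-Lagrange equation *)

Section EulerLagrange.
Context {R : realType} {n m : nat}.
Variables (a b gamma : R) (L : @Larg R n m -> R) (x : R -> 'rV[R]_m) (z : R -> R).
Hypotheses (ab : a < b) (n_gt0 : (0 < n)%N) (C1L : C1_on (Ldom a b) L).
Hypothesis ext : extremizer a b gamma L x z.

Let J : R -> @Larg R n m := jet a b x z.
Let X t : 'M[R]_(n.+1, m) := \matrix_(j < n.+1) Dn a b j x t.
Let psi := psiz a b L x z.
Let G := momentum a b L x z.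

Let px : PCn a b n x. Proof. by have [[]] := ext. Qed.
Let pz : PC1 a b z. Proof. by have [[]] := ext. Qed.

Let pX : PC a b X.
Proof.
apply: PC_mx => j k; have pj := PC_entry 0 k (PCn_PC ab n_gt0 px (ltn_ord j : (j <= n)%N)).
by apply: PC_eq pj; apply: but_finitelyT => t _; rewrite mxE.
Qed.

Let pu : PC a b z. Proof. by have [c _ _] := pz; exact: (PC_within ab c). Qed.

Let pD i : PC a b (fun t => 'D_(dir i) L (J t)).
Proof.
have := @PC_comp R a b _ _ (Ldom a b) (fun q => 'D_(dir i) L q) J.
move=> h; apply: h; [exact: Ldom_closed|exact: C1_on_continuous|by []|].
exact: (PC_point ab pX pu).
Qed.

Let apsi : antiderivative a b psi (fun t => - (psi t * 'D_(dir None) L (J t))).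
Proof. exact: (antiderivative_expR_tail ab (pD None)). Qed.

Let psib : psi b = 1.
Proof. by rewrite /psi /psiz set_itv1 Rintegral_set1 expR0. Qed.

Let ppsi : PC a b psi. Proof. by have [c _] := apsi; exact: (PC_within ab c). Qed.

Lemma momentum_PC j : PC a b (G j).
Proof.
apply: (PC_scale ppsi); apply: PC_mx => i k.
apply: PC_eq (pD (Some (inord j, k))); apply: but_finitelyT => t _.
by rewrite mxE.
Qed.

Lemma momentumE (j : 'I_n.+1) t k : G j t 0 k = psi t * 'D_(dir (Some (j, k))) L (J t).
Proof. by rewrite /G /momentum mxE mxE inord_val. Qed.

Let H := costate a b G.
Let d t := G n t - H n t.

Let pH j : PC a b (H j). Proof. exact: (costate_PC ab momentum_PC). Qed.
Let pd : PC a b d. Proof. exact: (PC_add (momentum_PC n) (PC_opp (pH n))). Qed.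

Let h k := iter_primitive a d k.
(** The jet of the variation [h n], off a finite set: differentiating [j] times undoes [j] of the
    [n] primitives. *)
Let Y t : 'M[R]_(n.+1, m) := \matrix_(j, k) h (n - j) t 0 k.

Let ph k : PC a b (h k). Proof. by have [] := iter_primitive_spec ab pd k. Qed.

Let pY : PC a b Y.
Proof.
apply: PC_mx => j k; apply: PC_eq (PC_entry 0 k (ph (n - j))).
by apply: but_finitelyT => t _; rewrite mxE.
Qed.

Let qf t := psi t * \sum_j \sum_k Y t j k * 'D_(dir (Some (j, k))) L (J t).

Let pqf : PC a b qf.
Proof.
apply: (PC_scale (V := R) ppsi).
apply: (PC_sum ab) => j; apply: (PC_sum ab) => k.
exact: (PC_scale (V := R) (PC_entry j k pY) (pD _)).
Qed.

Let Q := primitive a qf.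

(* Pointwise form of the integration by parts: the sum on the right is the
   derivative of the sum of the H (j+1) . h^(j), with h^(j) = h (n - j). *)
Let byparts t : \sum_k d t 0 k ^+ 2 = qf t - \sum_(j < n) \sum_k
  (H j.+1 t 0 k * h (n - j.+1) t 0 k + h (n - j) t 0 k * (G j t - H j t) 0 k).
Proof.
pose A j := \sum_k H j t 0 k * h (n - j) t 0 k.
pose B j := \sum_k h (n - j) t 0 k * G j t 0 k.
have -> : qf t = \sum_(j < n.+1) B j.
  rewrite /qf mulr_sumr; apply: eq_bigr => j _; rewrite mulr_sumr.
  by apply: eq_bigr => k _; rewrite momentumE mxE; ring.
have -> : \sum_(j < n) \sum_k
    (H j.+1 t 0 k * h (n - j.+1) t 0 k + h (n - j) t 0 k * (G j t - H j t) 0 k) =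
    \sum_(j < n) (A j.+1 - A j) + \sum_(j < n) B j.
  rewrite -big_split; apply: eq_bigr => j _ /=; rewrite /A /B -sumrB -big_split.
  by apply: eq_bigr => k _; rewrite !mxE /=; ring.
(* The terms in [H] telescope to [A n - A 0], and [A 0 = 0] because [H 0 = 0]. What remains pairs
   [G n - H n] with [h 0 = d]. *)
rewrite -(big_mkord xpredT (fun j => A j.+1 - A j)) telescope_sumr//.
have -> : A 0%N = 0 by rewrite /A big1// => k _; rewrite mxE mul0r.
rewrite big_ord_recr /= subr0 (_ : _ - _ = B n - A n); last by ring.
rewrite /A /B -sumrB; apply: eq_bigr => k _; rewrite subnn /h /= /d.
by rewrite !mxE; ring.
Qed.

(** The equation for [w] is that of the increment of [L], so adding [z' = L (J t)] restores the
    Herglotz equation along the perturbed jet. *)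
Let adm_variation (w : R -> R) (s : R) :
  antiderivative a b w (fun t => L (t, X t + s *: Y t, z t + w t) - L (J t)) ->
  w a = 0 -> admissible a b gamma L (fun t => x t + s *: h n t) (fun t => z t + w t).
Proof.
move=> aw wa; have [[_ _ dz za] _] := ext.
have [pxn Dh] := PCn_iter_primitive ab pd n_gt0.
have [pxh Dxh] := PCn_comb ab s n_gt0 px pxn.
have azw := antiderivativeD (PC1_antiderivative pz) aw.
have pzw : PC a b (fun t => D1 a b z t +
    (L (t, X t + s *: Y t, z t + w t) - L (J t))).
  apply: PC_add; first by have [] := pz.
  apply: PC_add; last exact: (PC_opp (PC_L ab C1L pX pu)).
  apply: (PC_L ab C1L).
    by apply: (PC_add pX); apply: PC_scale pY; exact: (PC_cst ab).
  by have [c _] := aw; exact: (PC_add pu (PC_within ab c)).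
split.
- exact: pxh.
- exact: (antiderivative_PC1 ab azw pzw).
- have E : but_finitely a b (fun t =>
      jet a b (fun t => x t + s *: h n t) (fun t => z t + w t) t =
      (t, X t + s *: Y t, z t + w t)).
    apply: but_finitely_imp2 Dxh Dh => t _ Ex Eh; congr (_, _, _).
    apply/matrixP => j k; have jn : (j <= n)%N by rewrite -ltnS.
    by rewrite !mxE Ex// Eh// !mxE.
  apply: but_finitely_imp2 E (but_finitely_and dz (antiderivative_D1 ab azw)).
  by move=> t _ -> [dzt [_ ->]]; rewrite dzt -/J addrC subrK.
- by rewrite za wa addr0.
Qed.

Let Qb : Q b = 0.
Proof.
have aQ : antiderivative a b Q qf by exact: primitiveP.
have [W [s0 [C [s00 C0 HW Wo]]]] :=
  first_variation ab C1L pX pY pu apsi psib aQ (primitive0 a qf).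
have [B B0 HB] := PC_bounded (ph n).
have [_ [eps eps0 Hext]] := ext.
(* [norm0_le] yields non-strict bounds; halving [eps] makes them the strict ones required of
   neighbours. *)
pose r := Num.min s0 (Num.min (eps / 2 / C) (eps / 2 / B)).
have r0 : 0 < r by rewrite !lt_min s00 !divr_gt0.
have small (s : R) : `|s| <= r -> [/\ `|s| <= s0, C * `|s| <= eps / 2 & B * `|s| <= eps / 2].
  rewrite !le_min => /andP[h1 /andP[h2 h3]]; split=> //.
    by rewrite mulrC -ler_pdivlMr.
  by rewrite mulrC -ler_pdivlMr.
have near s : `|s| <= r -> [/\
    admissible a b gamma L (fun t => x t + s *: h n t) (fun t => z t + W s t),
    norm0 a b ((fun t => z t + W s t) \- z) < eps &
    norm0 a b ((fun t => x t + s *: h n t) \- x) < eps].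
  move=> /small[h1 h2 h3]; have [aW Wa WC] := HW _ h1.
  have e2 : eps / 2 < eps by rewrite ltr_pdivrMr// ltr_pMr// ltr1n.
  split; first exact: adm_variation.
  - apply: le_lt_trans e2; apply: norm0_le => // t tab.
    by rewrite /= addrC addKr (le_trans (WC t tab)).
  - apply: le_lt_trans e2; apply: norm0_le => // t tab.
    rewrite /= addrC addKr normrZ mulrC; apply: le_trans h3.
    by rewrite ler_wpM2r// HB.
apply: (@linear_part_eq0 R (fun s => W s b) (Q b) r r0).
  move=> e e0; have [s1 s10 Hs1] := Wo _ e0; exists s1 => // s /small[h1 _ _] h2.
  exact: Hs1.
have WE s : z b + W s b - z b = W s b by rewrite addrC addKr.
case: Hext => Hext; [left|right] => s sr; rewrite -WE; exact: Hext (near s sr).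
Qed.

(** [Q - T] is nondecreasing, its derivative being the squared length of [d], and it vanishes at
    both ends. It is therefore constant, which forces [d = 0] off a finite set. *)
Lemma momentum_costate : but_finitely a b (fun t => G n t = H n t).
Proof.
have aQ : antiderivative a b Q qf by exact: primitiveP.
pose T t := \sum_(j < n) \sum_k H j.+1 t 0 k * h (n - j) t 0 k.
have aT : antiderivative a b T (fun t => \sum_(j < n) \sum_k
    (H j.+1 t 0 k * h (n - j.+1) t 0 k + h (n - j) t 0 k * (G j t - H j t) 0 k)).
  apply: antiderivative_sum => j; apply: antiderivative_sum => k.
  have [_ ah _] := iter_primitive_spec ab pd (n - j.+1)%N.
  rewrite subnSK// in ah.
  exact: (antiderivativeM (costate_step ab momentum_PC (pH j) 0 k) (ah 0 k)).
have aR : antiderivative a b (fun t => Q t - T t) (fun t => \sum_k d t 0 k ^+ 2).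
  apply: antiderivative_eq (antiderivativeB aQ aT).
  by apply: but_finitelyT => t _; rewrite byparts.
have Ra : Q a - T a = 0.
  rewrite /Q primitive0 /T big1 ?subr0// => j _; rewrite big1// => k _.
  have -> : h (n - j) a = 0 by rewrite -(subnSK (ltn_ord j)); exact: iter_primitive0.
  by rewrite [X in _ * X]mxE mulr0.
have Rb : Q b - T b = 0.
  rewrite Qb /T big1 ?subr0// => j _; rewrite big1// => k _.
  by rewrite /H costate_end mxE mul0r.
have d2 t : 0 <= \sum_k d t 0 k ^+ 2 by apply: sumr_ge0 => k _; exact: sqr_ge0.
have d2' : but_finitely a b (fun t => 0 <= \sum_k d t 0 k ^+ 2).
  by apply: but_finitelyT => t _.
have R0 t : t \in `[a, b] -> Q t - T t = 0.
  rewrite in_itv/= => /andP[at_ tb].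
  have h1 := antiderivative_ge0_le aR d2' (lexx a) at_ tb.
  have h2 := antiderivative_ge0_le aR d2' at_ tb (lexx b).
  by apply/eqP; rewrite eq_le; rewrite Ra in h1; rewrite Rb in h2; rewrite h1 h2.
(* The zero function now has the squared length of [d] as its derivative. *)
have [_ D0] := antiderivative_eql R0 aR.
apply: but_finitely_imp D0 => t tab [_ D0].
have {D0} : \sum_k d t 0 k ^+ 2 = 0 by rewrite -D0; exact: derive_cst.
move=> /psumr_eq0P d0; apply/rowP => k; apply/eqP; rewrite -subr_eq0.
have /eqP := d0 (fun i _ => sqr_ge0 (d t 0 i)) k isT.
by rewrite sqrf_eq0 /d !mxE.
Qed.

End EulerLagrange.

(** * The Euler--Lagrange equation and transversality, in nested and in classical form *)

Theorem theorem3p3 (R : realType) (n m : nat) (a b gamma : R)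
    (L : R * 'M[R]_(n.+1, m) * R -> R)
    (x : R -> 'rV[R]_m) (z : R -> R) (alpha : 'I_n -> 'rV[R]_m) :
  a < b -> (0 < n)%N -> (0 < m)%N ->
  C1_on (Ldom a b) L ->
  extremizer a b gamma L x z ->
  (forall j : 'I_n, Dn a b j x a = alpha j) ->
  let G := momentum a b L x z in
  alt_dsum a b n G (fun=> 0) /\
  exists psi : nat -> R -> 'rV[R]_m,
    (forall j, (1 <= j <= n)%N ->
       [/\ PC1 a b (psi j),
           alt_dsum a b (n - j) (fun i => G (i + j)%N) (fun t => - psi j t) &
           psi j b = 0]) /\
    (* On every subinterval where all the derivatives exist classically: *)
    (forall c d : R, a <= c -> c < d -> d <= b ->
       (forall j, (j <= n)%N -> Ck c d j (G j)) ->
       forall t : R, t \in `[c, d] ->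
         \sum_(j < n.+1) (-1) ^+ j *: Dn c d j (G j) t = 0 /\
         forall j, (1 <= j <= n)%N ->
           psi j t = \sum_(i < (n - j).+1)
                       (-1) ^+ i.+1 *: Dn c d i (G (i + j)%N) t).
Proof.
move=> ab n0 _ C1L ext _ G.
have pG j : PC a b (G j) by exact: (momentum_PC ab n0 C1L ext).
have Hn := momentum_costate ab n0 C1L ext.
split.
  (* [costate a b G 0] is the zero function by definition, so the case [j = 0] is the
     Euler--Lagrange equation. *)
  have := alt_dsum_costate ab pG Hn (addn0 n).
  have -> : (fun i => G (i + 0)%N) = G by apply/funext => i; rewrite addn0.
  exact.
exists (fun j t => - costate a b G j t); split.
  move=> [//|j] /andP[_ jn]; split.
  - have [pH _] := costate_PC1 ab pG j.
    (* The opposite is written as [H + (-2) *: H], the form covered by [PC1_comb]. *)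
    apply: (PC1_eq ab _ (PC1_comb ab (-2) pH pH).1) => s _.
    by rewrite scaleNr scaler_nat mulr2n opprD addrA subrr add0r.
  - have := alt_dsum_costate ab pG Hn (subnK jn).
    have -> : (fun t => - - costate a b G j.+1 t) = costate a b G j.+1.
      by apply/funext => t; rewrite opprK.
    exact.
  - by rewrite costate_end oppr0.
move=> c d ac cd db CG t tcd; split.
  transitivity (costate a b G 0 t); last exact: erefl.
  rewrite (costate_sum ab pG Hn ac cd db CG (addn0 n) tcd).
  by apply: eq_bigr => i _; rewrite addn0.
move=> j /andP[_ jn]; rewrite (costate_sum ab pG Hn ac cd db CG (subnK jn) tcd).
by rewrite -sumrN; apply: eq_bigr => i _; rewrite exprS mulN1r scaleNr.
Qed.
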